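(* Let $\nu_n$ be the average number of weak left to right maxima over all $\frac{1}{n+1}\binom{2n}{n}$ Dyck paths of semi-length $n$. Then, as $n\to\infty$, \[ \nu_n=\sqrt{\pi}\sqrt{n}-\log n+\frac{5-6\gamma}{2}+O(n^{-1/2}), \] where $\gamma$ is Euler's constant.
   Context: A Dyck path of semi-length $n$ is a lattice path from $(0,0)$ to $(2n,0)$ with $n$ up steps $(1,1)$ and $n$ down steps $(1,-1)$ never going below the $x$-axis. A peak is an up step immediately followed by a down step, and its height is the height of its top point. A weak left to right maximum is a peak whose height is greater than or equal to the heights of all peaks to its left. *)

(* Defs.v *)
(* MathComp-Analysis *)
From mathcomp Require Import all_boot all_order all_algebra.
From mathcomp Require Import all_classical all_reals all_analysis.
Import Order.TTheory GRing.Theory Num.Theory.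
Import numFieldNormedType.Exports.

Set Implicit Arguments.
Unset Strict Implicit.
Unset Printing Implicit Defensive.

Local Open Scope ring_scope.

(* A lattice path from the origin is its sequence of steps: [true] is the up
   step (1,1) and [false] is the down step (1,-1). *)

Definition height (p : seq bool) (k : nat) : int :=
  \sum_(b <- take k p) (if b then 1 else -1).

(* The step counts already force the end point (2n,0). *)
Definition Dyck (n : nat) : {set n.*2.-tuple bool} :=
  [set p : n.*2.-tuple bool |
    [&& count_mem true p == n, count_mem false p == n
      & [forall k : 'I_n.*2.+1, 0 <= height p k]]].

(* A peak is indexed by the position [i], counted from 0, of its up step, so
   its top point is the one reached after [i.+1] steps. *)
Definition peak (p : seq bool) (i : nat) : bool :=
  [&& (i.+1 < size p)%N, nth false p i & ~~ nth false p i.+1].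

Definition peak_height (p : seq bool) (i : nat) : int := height p i.+1.

Definition weak_lr_max (p : seq bool) (i : nat) : bool :=
  peak p i &&
  [forall j : 'I_i, peak p j ==> (peak_height p j <= peak_height p i)].

Definition num_weak_lr_max (p : seq bool) : nat :=
  count (weak_lr_max p) (iota 0 (size p)).

Definition nu (R : realType) (n : nat) : R :=
  (\sum_(p in Dyck n) num_weak_lr_max p)%N%:R / #|Dyck n|%:R.

Definition euler_gamma (R : realType) : R :=
  limn (fun n : nat => \sum_(1 <= k < n.+1) (k%:R : R)^-1 - ln (n%:R : R)).

(* Main.v *)
Require Import Defs.
From mathcomp Require Import all_boot all_order all_algebra.
From mathcomp Require Import all_classical all_reals all_analysis.
From mathcomp Require Import zify ring lra.
Import Order.TTheory GRing.Theory Num.Theory.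
Import numFieldNormedType.Exports.
Local Open Scope classical_set_scope.
Local Open Scope ring_scope.

(* A weak left to right maximum of height h splits a Dyck path as q U D r with q
   a path in the strip [0, h] and r nonnegative.  Reflection counts q, and the
   convolution with the counts of r collapses by cutting walks at a last visit.
   The total over Dyck paths of semi-length n becomes
     sum over m >= 3, j >= 1 of s(mj - 1),
   where c(k) = binom(2n, n + k) and s is the second difference of c.  The terms
   m = 1 and m = 2 are c(1) - c(0) and 0, so that, d being the divisor function,
     nu_n = 1 + (n + 1) / c(0) * sum_(N >= 1) d(N) s(N - 1).
   The hyperbola method shows that d and an explicit model built from harmonic
   numbers have fourfold iterated sums differing by O(X^2); summing by parts four
   times, the sixth differences of c make the replacement of d by the model cost
   O(n^(-1/2)).  The sum against the model is evaluated by telescoping identities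
   in terms of 4^n / c(0) (Wallis) and of the harmonic number H_n. *)

(** * Harmonic numbers *)

(** Why four summations. The weights live on N of order sqrt n, and each difference of c gains a
    factor n^(-1/2), so after k summations by parts an error X^e in the k-fold iterated sums costs
    n^((1 + e - k)/2). In the elementary hyperbola method the row of index a leaves an error
    a^(k-1); summed over a <= sqrt X this gives e = k/2, and k = 4 is the first value for which the
    cost is n^(-1/2). Nothing deeper about the divisor problem is then needed, but the model must
    reproduce the lower order terms of the fourfold sums too, not only log N + 2 gamma. No local
    limit theorem is used: all sums are finite, and Gaussian tails are replaced by even moments of
    binomial rows. The constant 5/2 - 3 gamma is 1, left by the row m = 1, plus 3/2 - 2 gamma from
    the model, minus the gamma contained in H_n. *)

Lemma le_of_is_derive_ge0 (R : realType) (f f' : R -> R) (a b : R) :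
  a <= b ->
  (forall x, a <= x <= b -> is_derive x 1 f (f' x)) ->
  (forall x, a <= x <= b -> 0 <= f' x) ->
  f a <= f b.
Proof.
move=> ab fd f'_ge0.
apply: (@ger0_derive1_ndecr R f a b) => //.
- move=> x /[!in_itv]/= /andP[ax xb].
  by have [] : is_derive x 1 f (f' x) by apply: fd; rewrite !ltW.
- move=> x /[!in_itv]/= /andP[ax xb].
  have xab : a <= x <= b by rewrite !ltW.
  by rewrite derive1E (@derive_val _ _ _ _ _ _ _ (fd _ xab)) f'_ge0.
- apply: derivable_within_continuous => x /[!in_itv]/= xab.
  by have [] := fd _ xab.
Qed.

(** With its sign, the remainder vanishes at 0 and has derivative [x ^+ k / (1 + x)] by the
    geometric sum, so the Taylor polynomials of the logarithm bound it alternately from below and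
    from above. *)
Lemma ln1D_taylor (R : realType) (k : nat) (u : R) : 0 <= u ->
  0 <= (-1) ^+ k * (ln (1 + u) - \sum_(i < k) (-1) ^+ i * (u ^+ i.+1 / i.+1%:R)).
Proof.
move=> u0.
pose t (i : nat) : R -> R := fun x => (-1) ^+ i * (x ^+ i.+1 / i.+1%:R).
pose f : R -> R := fun x => (-1) ^+ k * (ln (1 + x) - \sum_(i < k) t i x).
suff : f 0 <= f u.
  rewrite /f addr0 ln1 big1 ?subr0 ?mulr0// => i _.
  by rewrite /t expr0n/= mul0r mulr0.
have dt i (x : R) : is_derive x 1 (t i) ((- x) ^+ i).
  rewrite (_ : t i = ((-1) ^+ i / i.+1%:R) \*: (@id R ^+ i.+1)); last first.
    by apply/funext => y; rewrite /t /= fctE /GRing.scale/= mulrAC mulrA.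
  apply: is_derive_eq; rewrite /GRing.scale/= mulr1.
  rewrite -[in RHS]mulN1r exprMn.
  have i0 : i.+1%:R != 0 :> R by rewrite pnatr_eq0.
  by rewrite /= mulrA divfK.
apply: (@le_of_is_derive_ge0 _ f (fun x => x ^+ k / (1 + x))) => // x /andP[x0 _].
  have x1 : 0 < 1 + x by lra.
  have ? := is_derive1_ln x1.
  have dS : is_derive x 1 (fun y => \sum_(i < k) t i y) (\sum_(i < k) (- x) ^+ i).
    rewrite (_ : (fun y => _) = \sum_(i < k) t i); last first.
      by apply/funext => y; rewrite fct_sumE.
    exact: is_derive_sum.
  rewrite /f; apply: is_derive_eq.
  rewrite /GRing.scale/= !(mul0r, mulr0, addr0, add0r, mulr1, mul1r).
  have := subrX1 (- x) k; set S := \sum_(i < k) _ => hS.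
  have -> : S = (1 - (- x) ^+ k) / (1 + x).
    by apply: (mulIf (lt0r_neq0 x1)); rewrite divfK ?lt0r_neq0//; lra.
  have -> : (- x) ^+ k = (-1) ^+ k * x ^+ k by rewrite -exprMn mulN1r.
  have := signrMK k (x ^+ k) => {2}<-.
  by field; lra.
by rewrite divr_ge0 ?exprn_ge0//; lra.
Qed.

Lemma ln1D_ge (R : realType) (u : R) : 0 <= u ->
  u - u ^+ 2 / 2 + u ^+ 3 / 3 - u ^+ 4 / 4 <= ln (1 + u).
Proof. by move=> /(ln1D_taylor _ 4); rewrite !big_ord_recr big_ord0/=; lra. Qed.

Lemma ln1D_le (R : realType) (u : R) : 0 <= u ->
  ln (1 + u) <= u - u ^+ 2 / 2 + u ^+ 3 / 3 - u ^+ 4 / 4 + u ^+ 5 / 5.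
Proof. by move=> /(ln1D_taylor _ 5); rewrite !big_ord_recr big_ord0/=; lra. Qed.

Lemma ln1D_le3 (R : realType) (u : R) : 0 <= u ->
  ln (1 + u) <= u - u ^+ 2 / 2 + u ^+ 3 / 3.
Proof. by move=> /(ln1D_taylor _ 3); rewrite !big_ord_recr big_ord0/=; lra. Qed.

Definition harm (R : realType) (n : nat) : R := \sum_(1 <= k < n.+1) k%:R^-1.

Lemma harm0 (R : realType) : harm R 0 = 0.
Proof. by rewrite /harm big_geq. Qed.

Lemma harmS (R : realType) (n : nat) : harm R n.+1 = harm R n + n.+1%:R^-1.
Proof. by rewrite /harm big_nat_recr. Qed.

(* The Euler-Maclaurin truncation with error O(n^-4): that precision is needed
   because the harmonic number of A ~ sqrt X gets multiplied by X^4. *)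
Definition harm_err (R : realType) (n : nat) : R :=
  harm R n - ln n%:R - (2 * n%:R)^-1 + (12 * n%:R ^+ 2)^-1.

(** Squeezing the logarithm of 1 + 1/n between its Taylor polynomials of degrees 4 and 5 leaves two
    rational inequalities. The bound is a difference so that it telescopes in [harm_err_bound]. *)
Lemma harm_errS (R : realType) (n : nat) : (0 < n)%N ->
  `|harm_err R n.+1 - harm_err R n| <= (n%:R ^+ 4)^-1 - (n.+1%:R ^+ 4)^-1.
Proof.
move=> n0; have x1 : 1 <= n%:R :> R by rewrite ler1n.
rewrite /harm_err harmS -natr1.
set x : R := n%:R in x1 *.
have u0 : 0 <= x^-1 by rewrite invr_ge0; lra.
have -> : ln (x + 1) = ln x + ln (1 + x^-1).
  rewrite -lnM ?posrE; [|lra|lra].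
  by rewrite mulrDr mulr1 divff//; lra.
have := ln1D_ge _ _ u0; have := ln1D_le _ _ u0.
set l := ln (1 + _); move: (ln x) (harm R n) => L h.
move=> lle lge.
set P4 := x^-1 - _ + _ - _ in lle lge.
have -> : h + (x + 1)^-1 - (L + l) - (2 * (x + 1))^-1 + (12 * (x + 1) ^+ 2)^-1 -
   (h - L - (2 * x)^-1 + (12 * x ^+ 2)^-1) =
   ((x + 1)^-1 - P4 - (2 * (x + 1))^-1 + (12 * (x + 1) ^+ 2)^-1
   + (2 * x)^-1 - (12 * x ^+ 2)^-1) + (P4 - l) by ring.
rewrite ler_norml.
set E := (X in X + (P4 - l)); set D := (X in _ <= _ <= X).
have y0 : x + 1 != 0 by lra.
have x0 : x != 0 by lra.
have xp n0' : 0 < x ^+ n0' by rewrite exprn_gt0//; lra.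
have yp n0' : 0 < (x + 1) ^+ n0' by rewrite exprn_gt0//; lra.
(* Since [P4 - l] lies between [- x^-1 ^+ 5 / 5] and 0, the upper bound needs only [E <= D], and the
   lower one [x^-1 ^+ 5 / 5 <= D + E]; both numerators are nonnegative for [1 <= x]. *)
have hU : D - E = (46 * x ^+ 3 + 65 * x ^+ 2 + 40 * x + 9)
    / (12 * (x ^+ 4 * (x + 1) ^+ 4)).
  by rewrite /D /E /P4; field; rewrite x0 y0.
have hL : D + E - x^-1 ^+ 5 / 5 =
   (238 * x ^+ 4 + 347 * x ^+ 3 + 208 * x ^+ 2 + 27 * x - 12)
    / (60 * (x ^+ 5 * (x + 1) ^+ 4)).
  by rewrite /D /E /P4; field; rewrite x0 y0.
have hU0 : 0 <= D - E.
  rewrite hU; apply: divr_ge0; last first.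
    by apply: mulr_ge0 => //; apply: mulr_ge0; exact/ltW.
  by have := xp 3; have := xp 2; lra.
have hL0 : 0 <= D + E - x^-1 ^+ 5 / 5.
  rewrite hL; apply: divr_ge0; last first.
    by apply: mulr_ge0 => //; apply: mulr_ge0; exact/ltW.
  by have := xp 4; have := xp 3; have := xp 2; lra.
rewrite -/D; move: hU0 hL0 lle lge; clear hU hL; clearbody E D P4.
move=> hU0 hL0 lle lge; by apply/andP; split; lra.
Qed.

Lemma harm_err_bound (R : realType) (n m : nat) : (0 < n)%N -> (n <= m)%N ->
  `|harm_err R m - harm_err R n| <= (n%:R ^+ 4)^-1 - (m%:R ^+ 4)^-1.
Proof.
move=> n0; elim: m => [|m IH] /=; first by rewrite leqNgt n0.
rewrite leq_eqVlt ltnS => /predU1P[<-|nm]; first by rewrite !subrr normr0.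
have m0 : (0 < m)%N by exact: leq_trans nm.
have := lerD (harm_errS R m m0) (IH nm); rewrite [X in _ <= X -> _]addrC subrKA.
apply: le_trans; rewrite -[X in `|X - _|](subrK (harm_err R m)) -addrA.
exact: ler_normD.
Qed.

Lemma ln_natS_bounds (R : realType) (n : nat) : (0 < n)%N ->
  (n.+1%:R)^-1 <= ln n.+1%:R - ln (n%:R : R) :> R.
Proof.
move=> n0; rewrite -[leLHS]opprK lerNl opprB -ln_div ?posrE ?ltr0n//.
have -> : n%:R / n.+1%:R = 1 + (- n.+1%:R^-1) :> R.
  by rewrite -natr1; field; rewrite natr1 pnatr_eq0.
apply: le_ln1Dx; rewrite ltrN2 invf_lt1 ?ltr1n ?ltr0n//.
Qed.

Lemma ln_natS_le_harm (R : realType) (n : nat) : ln n.+1%:R <= harm R n.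
Proof.
elim: n => [|n IH]; first by rewrite harm0 ln1.
rewrite harmS; suff h : ln n.+2%:R - ln n.+1%:R <= n.+1%:R^-1 :> R.
  by have := lerD h IH; rewrite subrK [X in _ <= X -> _]addrC.
rewrite -ln_div ?posrE ?ltr0n//.
have -> : n.+2%:R / n.+1%:R = 1 + n.+1%:R^-1 :> R.
  by rewrite -natr1; field; rewrite ?pnatr_eq0.
by apply: le_ln1Dx; rewrite (lt_trans (ltrN10 _))// invr_gt0 ltr0n.
Qed.

Lemma cvg_harm_ln (R : realType) :
  cvgn (fun n : nat => harm R n - ln (n%:R : R)).
Proof.
set u := fun n => _.
(* At index 0 [ln] has only its default value, so monotonicity is shown from index 1 on. *)
suff : cvgn [sequence u n.+1]_n.
  move=> /cvg_ex[l] /= hl; apply/cvg_ex; exists l.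
  by rewrite -cvg_shiftS.
rewrite /u; apply: nonincreasing_is_cvgn.
  apply/nonincreasing_seqP => n; rewrite /= harmS.
  have := ln_natS_bounds R n.+1 isT.
  by move: (n.+2%:R^-1) (ln n.+2%:R) (ln n.+1%:R) => a b c; lra.
exists 0 => _ [n _ <-].
rewrite subr_ge0; apply: le_trans (ln_natS_le_harm R n.+1).
by rewrite ler_ln ?posrE ?ltr0n// ler_nat.
Qed.

Lemma cvg_harm_err (R : realType) : harm_err R @ \oo --> euler_gamma R.
Proof.
have h : (fun n : nat => harm R n - ln (n%:R : R)) @ \oo --> euler_gamma R.
  exact: cvg_harm_ln.
rewrite -cvg_shiftS.
have h1 : [sequence harm R n.+1 - ln (n.+1%:R : R)]_n @ \oo --> euler_gamma R.
  by rewrite (@cvg_shiftS _ (fun n => harm R n - ln n%:R)).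
have h2 : (fun n => (n.+1%:R : R)^-1) @ \oo --> (0 : R) by exact: cvg_harmonic.
rewrite (_ : [sequence _]_n = (fun n => harm R n.+1 - ln (n.+1%:R : R)
  - 2^-1 * (n.+1%:R)^-1 + 12^-1 * ((n.+1%:R)^-1 * (n.+1%:R)^-1))); last first.
  by apply/funext => n /=; rewrite /harm_err !invfM.
have -> : euler_gamma R = euler_gamma R - 2^-1 * 0 + 12^-1 * (0 * 0).
  by rewrite !mulr0 subr0 addr0.
by apply: cvgD; [apply: cvgB => //; apply: cvgMr|apply: cvgMr; apply: cvgM].
Qed.

Lemma harm_expansion (R : realType) (n : nat) : (0 < n)%N ->
  `|harm_err R n - euler_gamma R| <= (n%:R ^+ 4)^-1.
Proof.
move=> n0; have h := @cvg_harm_err R.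
rewrite ler_norml; apply/andP; split.
  rewrite lerBrDl -lerBrDr opprK; apply: (cvgr_to_le h).
  exists n => // m /= nm; have /ler_normlP[_ +] := harm_err_bound R n m n0 nm.
  have : 0 <= (m%:R ^+ 4)^-1 :> R by rewrite invr_ge0 exprn_ge0.
  by move: (n%:R ^+ 4)^-1 (m%:R ^+ 4)^-1 => a b; lra.
rewrite lerBlDr -lerBlDl; apply: (cvgr_to_ge h).
exists n => // m /= nm; have /ler_normlP[+ _] := harm_err_bound R n m n0 nm.
have : 0 <= (m%:R ^+ 4)^-1 :> R by rewrite invr_ge0 exprn_ge0.
by move: (n%:R ^+ 4)^-1 (m%:R ^+ 4)^-1 => a b; lra.
Qed.

(** * Walks on the integers and Dyck words *)

(** The number of walks of [l] steps 1 or -1 from 0 to [y]. Values are in [int] so that signed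
    images and differences avoid truncated subtraction. *)
Fixpoint walk (l : nat) (y : int) : int :=
  if l is l'.+1 then walk l' (y - 1) + walk l' (y + 1) else (y == 0)%:R.

Lemma walkN (l : nat) (y : int) : walk l (- y) = walk l y.
Proof.
elim: l y => [|l IH] y /=; first by rewrite oppr_eq0.
rewrite -(IH (y - 1)) -(IH (y + 1)) [RHS]addrC.
by congr (walk _ _ + walk _ _); lia.
Qed.

Lemma walk_abs (l : nat) (y : int) : walk l `|y| = walk l y.
Proof. by case: (ger0P y) => // _; rewrite walkN. Qed.

Lemma walk_out (l : nat) (y : int) : l%:Z < `|y| -> walk l y = 0.
Proof.
elim: l y => [|l IH] y ly /=; first by rewrite -normr_eq0 gt_eqF.
by rewrite !IH ?addr0//; lia.
Qed.

Lemma walk_bin (l j : nat) : walk l (j%:Z *+ 2 - l%:Z) = 'C(l, j)%:R.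
Proof.
elim: l j => [|l IH] [|j] /=.
- by [].
- by rewrite bin0n; case: eqP => //; lia.
- rewrite walk_out; last lia.
  by rewrite add0r -[X in walk _ X](_ : 0%:Z *+ 2 - l%:Z = _) ?IH ?bin0//; lia.
- rewrite binS natrD -!IH addrC; congr (walk _ _ + walk _ _); lia.
Qed.

(** Doubling the endpoint removes the parity condition: this is c(k) of the overview, extended by
    zero to all integers. *)
Definition cwalk (n : nat) (k : int) : int := walk n.*2 (k *+ 2).

Definition cdiff2 (n : nat) (k : int) : int :=
  cwalk n (k + 1) - cwalk n k *+ 2 + cwalk n (k - 1).

Lemma cwalkN (n : nat) (k : int) : cwalk n (- k) = cwalk n k.
Proof. by rewrite /cwalk mulNrn walkN. Qed.

Lemma cwalk_bin (n k : nat) : cwalk n k = 'C(n.*2, n + k)%:R.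
Proof. by rewrite /cwalk -walk_bin; congr (walk _ _); lia. Qed.

Lemma cwalk_out (n : nat) (k : int) : n%:Z < `|k| -> cwalk n k = 0.
Proof. by move=> nk; rewrite /cwalk walk_out//; lia. Qed.

(** Recursion on words replaces sums over tuples: conditioning on the first step and cutting at a
    position become structural. *)
Fixpoint wsum (L : nat) (F : seq bool -> int) : int :=
  if L is L'.+1 then
    wsum L' (fun w => F (true :: w)) + wsum L' (fun w => F (false :: w))
  else F [::].

Lemma wsum_tuple (L : nat) (F : seq bool -> int) :
  \sum_(p : L.-tuple bool) F p = wsum L F.
Proof.
elim: L F => [|L IH] F /=.
  by rewrite (big_pred1 [tuple]) // => t; apply/esym/eqP/val_inj; case: t => -[].
rewrite -!IH; pose f (x : bool * L.-tuple bool) := [tuple of x.1 :: x.2].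
rewrite (reindex f) /=; last first.
  exists (fun t => (thead t, [tuple of behead t])) => [[b t] _|t _].
    by rewrite /f /= theadE; congr (_, _); apply/val_inj.
  by apply/val_inj; rewrite /= [in RHS](tuple_eta t).
rewrite -(pair_bigA _ (fun b (t : L.-tuple bool) => F (b :: t))) /=.
by rewrite big_bool.
Qed.

Lemma eq_wsum (L : nat) (F G : seq bool -> int) :
  (forall w, size w = L -> F w = G w) -> wsum L F = wsum L G.
Proof.
elim: L F G => [|L IH] F G FG /=; first exact: FG.
by congr (_ + _); apply: IH => w wL; apply: FG; rewrite /= wL.
Qed.

Lemma wsum_cat (a b : nat) (F : seq bool -> int) :
  wsum (a + b) F = wsum a (fun q => wsum b (fun r => F (q ++ r))).
Proof. by elim: a F => [|a IH] F //=; rewrite !IH. Qed.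

Lemma wsum0 (L : nat) : wsum L (fun=> 0) = 0.
Proof. by elim: L => //= L ->. Qed.

Lemma wsumD (L : nat) (F G : seq bool -> int) :
  wsum L (fun w => F w + G w) = wsum L F + wsum L G.
Proof. by elim: L F G => //= L IH F G; rewrite !IH addrACA. Qed.

Lemma wsumZ (L : nat) (c : int) (F : seq bool -> int) :
  wsum L (fun w => c * F w) = c * wsum L F.
Proof. by elim: L F => //= L IH F; rewrite !IH mulrDr. Qed.

Lemma wsum_sum (I : Type) (r : seq I) (L : nat) (F : I -> seq bool -> int) :
  wsum L (fun w => \sum_(i <- r) F i w) = \sum_(i <- r) wsum L (F i).
Proof.
elim: r => [|i r IH].
  by rewrite big_nil -[RHS](wsum0 L); apply: eq_wsum => w _; rewrite big_nil.
by rewrite big_cons -IH -wsumD; apply: eq_wsum => w _; rewrite big_cons.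
Qed.

Definition step (b : bool) : int := if b then 1 else -1.

Definition rise (w : seq bool) : int := \sum_(b <- w) step b.

Lemma rise_nil : rise [::] = 0. Proof. exact: big_nil. Qed.

Lemma rise_cons (b : bool) (w : seq bool) : rise (b :: w) = step b + rise w.
Proof. exact: big_cons. Qed.

Lemma rise_cat (q r : seq bool) : rise (q ++ r) = rise q + rise r.
Proof. exact: big_cat. Qed.

Lemma heightE (w : seq bool) (k : nat) : height w k = rise (take k w).
Proof. by []. Qed.

(** The starting level is an argument so that a suffix can be treated at the level where it begins.
    All visited levels are tested, the first and the last included. *)
Fixpoint stays (P : pred int) (y : int) (w : seq bool) : bool :=
  P y && (if w is b :: w' then stays P (y + step b) w' else true).

Lemma staysP (P : pred int) (y : int) (w : seq bool) :
  reflect (forall k, (k <= size w)%N -> P (y + rise (take k w))) (stays P y w).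
Proof.
elim: w y => [|b w IH] y /=.
  rewrite andbT; apply: (iffP idP) => [Py [|]// _|]; first by rewrite rise_nil addr0.
  by move=> /(_ 0%N isT); rewrite rise_nil addr0.
apply: (iffP andP) => [[Py /IH h] [|k] kw|h].
- by rewrite rise_nil addr0.
- by rewrite /= rise_cons addrA h.
split; first by have := h 0%N isT; rewrite rise_nil addr0.
by apply/IH => k kw; have := h k.+1 kw; rewrite /= rise_cons addrA.
Qed.

Lemma stays_cat (P : pred int) (y : int) (q r : seq bool) :
  stays P y (q ++ r) = stays P y q && stays P (y + rise q) r.
Proof.
elim: q y => [|b q IH] y /=.
  rewrite rise_nil addr0 andbT; case: r => [|b r] /=; first by rewrite andbT andbb.
  by rewrite andbA andbb.
by rewrite IH rise_cons addrA andbA.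
Qed.

Definition dyck_word (w : seq bool) : bool :=
  stays (fun y => 0 <= y) 0 w && (rise w == 0).

Lemma rise_count (w : seq bool) :
  rise w = (count_mem true w)%:Z - (count_mem false w)%:Z.
Proof.
elim: w => [|b w IH]; first by rewrite rise_nil.
by rewrite rise_cons IH /=; case: b => /=; lia.
Qed.

Lemma mem_Dyck (n : nat) (p : n.*2.-tuple bool) : (p \in Dyck n) = dyck_word p.
Proof.
rewrite inE /dyck_word rise_count.
have cnt : (count_mem true p + count_mem false p = n.*2)%N.
  rewrite -[RHS](size_tuple p) -(count_predC (pred1 true) p); congr (_ + _)%N.
  by apply: eq_count; case.
have -> : [forall k : 'I_n.*2.+1, 0 <= height p k] = stays (fun y => 0 <= y) 0 p.
  apply/forallP/staysP => [h k kp|h k].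
    rewrite add0r; rewrite size_tuple in kp.
    exact: (h (Ordinal (kp : (k < n.*2.+1)%N))).
  by have := h k; rewrite add0r size_tuple -ltnS => ->.
rewrite andbA [LHS]andbC; congr (_ && _).
by apply/andP/eqP => [[/eqP + /eqP +]|+]; lia.
Qed.

(** * Counting constrained walks: last visits and reflection *)

Definition num_paths (P : pred int) (y z : int) (L : nat) : int :=
  wsum L (fun w => (stays P y w && (y + rise w == z))%:R).

Lemma num_paths0 (P : pred int) (y z : int) :
  num_paths P y z 0 = (P y && (y == z))%:R.
Proof. by rewrite /num_paths /= rise_nil addr0 andbT. Qed.

Lemma num_paths_out (P : pred int) (y z : int) (L : nat) :
  ~~ P y -> num_paths P y z L = 0.
Proof.
move=> /negbTE Py; rewrite -[RHS](wsum0 L); apply: eq_wsum => w _.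
by case: w => [|b w] /=; rewrite Py.
Qed.

Lemma num_pathsS (P : pred int) (y z : int) (L : nat) : P y ->
  num_paths P y z L.+1 = num_paths P (y + 1) z L + num_paths P (y - 1) z L.
Proof.
move=> Py; rewrite /num_paths /=.
by congr (_ + _); apply: eq_wsum => w _; rewrite Py rise_cons addrA.
Qed.

Definition nonneg_paths (L : nat) (d : int) : int :=
  num_paths (fun y => 0 <= y) d 0 L.

(* Cut a walk ending at distance [d + 1] beyond level [a] at its last visit to
   level [a]: what follows is, reversed, a first passage. *)
Lemma walk_last_visit (L a d : nat) :
  \sum_(i < L.+1) walk i a * nonneg_paths (L - i) d = walk L.+1 (a + d + 1)%N.
Proof.
elim: L d => [|L IH] d.
  rewrite big_ord_recl big_ord0 addr0 /nonneg_paths num_paths0 /=.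
  by case: a => [|a]; case: d => [|d]; rewrite ?mul0r ?mulr0 /=; lia.
rewrite big_ord_recr /= subnn.
under eq_bigr => i _.
  rewrite /nonneg_paths subSn; last by rewrite -ltnS.
  rewrite num_pathsS // mulrDr.
  rewrite -[(d%:Z + 1)](_ : d.+1%:Z = _); last lia.
  rewrite -!/(nonneg_paths _ _).
  over.
rewrite big_split /= IH /nonneg_paths num_paths0 /=.
rewrite [in RHS](_ : (a + d + 1)%N%:Z + 1 = (a + d.+1 + 1)%N); last lia.
case: d => [|d].
  rewrite big1 ?addr0 ?mulr1 => [|i _]; last by rewrite num_paths_out ?mulr0.
  by rewrite addrC; congr (walk _ _ + walk _ _ + _); lia.
have -> : (d.+1%:Z == 0) = false by [].
rewrite mulr0 addr0.
under eq_bigr => i _.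
  rewrite [d.+1%:Z - 1](_ : _ = d%:Z); last lia.
  rewrite -/(nonneg_paths _ _).
  over.
rewrite IH /= addrC; congr (walk _ _ + walk _ _ + _); lia.
Qed.

(** Images produced by reflection lie on both sides of 0; symmetry of [walk] brings them to a
    nonnegative level. *)
Lemma walk_last_visit_abs (L d : nat) (e : int) :
  \sum_(i < L.+1) walk i e * nonneg_paths (L - i) d = walk L.+1 (`|e| + d%:Z + 1).
Proof.
under eq_bigr do rewrite -walk_abs.
have -> : `|e| = `|e|%N%:Z :> int by rewrite abszE.
by rewrite walk_last_visit; congr (walk _ _); lia.
Qed.

Lemma nonneg_paths_reflection (L : nat) (y : int) : -1 <= y ->
  nonneg_paths L y = walk L y - walk L (y + 2).
Proof.
elim: L y => [|L IH] y y1.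
  by rewrite /nonneg_paths num_paths0 /=; lia.
case: (ltrP y 0) => [y0|y0].
  have -> : y = -1 by lia.
  rewrite /nonneg_paths num_paths_out // -walkN.
  by rewrite [- -1](_ : _ = -1 + 2) ?subrr.
rewrite /nonneg_paths num_pathsS // -!/(nonneg_paths _ _) !IH; [|lia|lia].
rewrite /= [y + 1 + 2](_ : _ = y + 2 + 1); last lia.
rewrite [y - 1 + 2](_ : _ = y + 2 - 1); last lia.
by lia.
Qed.

Lemma card_Dyck (n : nat) : #|Dyck n|%:R = cwalk n 0 - cwalk n 1.
Proof.
rewrite /cwalk -nonneg_paths_reflection // -sum1_card natr_sum.
rewrite /nonneg_paths /num_paths -wsum_tuple big_mkcond /=.
by apply: eq_bigr => p _; rewrite mem_Dyck /dyck_word add0r; case: (_ && _).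
Qed.

(* Reflection principle for the strip -1 < y < h + 1 with m = h + 2: the images
   of the target z are z + 2km with sign + and -2 - z + 2km with sign -. *)
Definition refl_term (L : nat) (m z y k : int) : int :=
  walk L (z - y + k * m *+ 2) - walk L (z + 2 + y + k * m *+ 2).

Lemma sum_refl_term_bot (K L : nat) (m z : int) :
  \sum_(0 <= i < K.*2.+1) refl_term L m z (- 1) (i%:Z - K%:Z) = 0.
Proof.
rewrite big1 // => i _; rewrite /refl_term; apply/eqP; rewrite subr_eq0.
by apply/eqP; congr (walk _ _); lia.
Qed.

(** At the upper barrier the negative image of index k coincides with the positive one of index k +
    1, so the sum telescopes; the two images left at the ends are out of reach of [L] steps. *)
Lemma sum_refl_term_top (h K L : nat) : (L < K)%N ->
  \sum_(0 <= i < K.*2.+1)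
    refl_term L (h%:Z + 2) (h%:Z - 1) (h%:Z + 1) (i%:Z - K%:Z) = 0.
Proof.
move=> LK; pose u (i : nat) := - walk L ((i%:Z - K%:Z) * (h%:Z + 2) *+ 2 - 2).
rewrite (eq_bigr (fun i => u i.+1 - u i)) => [|i _]; last first.
  rewrite /u /refl_term opprK addrC; congr (- walk _ _ + walk _ _); last by lia.
  have -> : i.+1%:Z = i%:Z + 1 by lia.
  by ring.
by rewrite telescope_sumr // /u !walk_out; [rewrite subrr|nia|nia].
Qed.

(** Both sides obey the same recurrence in [L], vanish at the barriers -1 and [h + 1], and agree for
    [L = 0], where only the image of index 0 counts. The target [h - 1] is the level from which the
    up step of a peak of height [h] starts. *)
Lemma strip_paths_reflection (h K L : nat) (y : int) : (0 < h)%N -> (L < K)%N ->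
  -1 <= y <= h%:Z + 1 ->
  num_paths (fun y => 0 <= y <= h%:Z) y (h%:Z - 1) L =
  \sum_(0 <= i < K.*2.+1) refl_term L (h%:Z + 2) (h%:Z - 1) y (i%:Z - K%:Z).
Proof.
move=> h0; elim: L y => [|L IH] y LK /andP[y1 yh].
all: case: (boolP (0 <= y <= h%:Z)) => [/andP[y0 yh']|yout]; last first.
1,3: rewrite num_paths_out //;
  have [->|->] : (y = -1 \/ y = h%:Z + 1) by lia.
1,3: by rewrite sum_refl_term_bot.
1,2: by rewrite sum_refl_term_top.
  rewrite num_paths0 y0 yh' /= (bigD1_seq K) ?mem_index_iota ?iota_uniq //=; last by lia.
  rewrite big1 => [|i iK]; first by rewrite /refl_term /= subrr !mul0r !mul0rn; lia.
  rewrite /refl_term /=; apply/eqP; rewrite subr_eq0; apply/eqP; congr (_%:R).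
  have [iK1|iK1] : (i%:Z - K%:Z <= -1 \/ 1 <= i%:Z - K%:Z) by lia.
    by transitivity false; apply/eqP; nia.
  by transitivity false; apply/eqP; nia.
rewrite num_pathsS ?y0 ?yh' // !IH; try lia.
rewrite -big_split; apply: eq_bigr => i _; rewrite /refl_term /=.
set t := (_ * _) *+ 2; rewrite addrACA -opprD [X in _ - X = _]addrC.
by congr (walk _ _ + walk _ _ - (walk _ _ + walk _ _)); lia.
Qed.

(** * Cutting a Dyck word at a weak left to right maximum *)

Lemma rise_take_S (q : seq bool) (k : nat) : (k < size q)%N ->
  rise (take k.+1 q) = rise (take k q) + step (nth false q k).
Proof.
by move=> kq; rewrite (take_nth false) // -cats1 rise_cat /rise big_seq1.
Qed.

(** The condition on earlier peaks becomes one on all vertices of [q]. If [q] exceeds [rise q + 1],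
    a position where it is maximal is neither its first nor its last vertex, hence the top of an
    earlier and higher peak. *)
Lemma weak_lr_max_cat (q r : seq bool) :
  stays (fun y => 0 <= y) 0 q ->
  weak_lr_max (q ++ true :: false :: r) (size q) =
  stays (fun y => y <= rise q + 1) 0 q.
Proof.
move=> /staysP q0; set w := q ++ _.
have rq0 : 0 <= rise q by have := q0 _ (leqnn _); rewrite take_size add0r.
have hw k : (k <= size q)%N -> height w k = rise (take k q).
  by move=> kq; rewrite heightE /w takel_cat.
have nw k : (k < size q)%N -> nth false w k = nth false q k.
  by move=> kq; rewrite /w nth_cat kq.
have sw : (size q < size w)%N by rewrite /w size_cat /=; lia.
have hi : peak_height w (size q) = rise q + 1.
  rewrite /peak_height heightE /w -cat_rcons take_size_cat ?size_rcons //.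
  by rewrite -cats1 rise_cat rise_cons rise_nil addr0.
have -> : weak_lr_max w (size q) = [forall j : 'I_(size q),
    peak w j ==> (peak_height w j <= rise q + 1)].
  have sqF : ((size q).+1 < size q)%N = false by lia.
  rewrite /weak_lr_max hi /peak /w !nth_cat ltnn subnn sqF subSnn /=.
  have -> // : ((size q).+1 < size (q ++ [:: true, false & r]))%N.
  by rewrite size_cat /=; lia.
apply/forallP/staysP => [pk k kq|st j]; last first.
  apply/implyP => _; rewrite /peak_height hw //.
  by have := st j.+1 (ltn_ord j); rewrite add0r.
rewrite add0r leNgt; apply/negP => kgt.
pose H (k : 'I_(size q).+1) := rise (take k q).
case: (@arg_maxP _ _ _ ord0 xpredT H) => // m _ mmax.
have mgt : rise q + 1 < H m.
  by apply: (lt_le_trans kgt); apply: (mmax (Ordinal (kq : (k < (size q).+1)%N))).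
have mq : (m < size q)%N.
  rewrite ltn_neqAle -ltnS ltn_ord andbT; apply/eqP => mE.
  by move: mgt; rewrite /H mE take_size; lia.
have m0 : (0 < m)%N.
  by rewrite lt0n; apply/eqP => mE; move: mgt; rewrite /H mE take0 rise_nil; lia.
have m1q : (m.-1 < size q)%N by rewrite prednK //; lia.
have up : nth false q m.-1.
  apply/negP => /negP nup.
  have m1 : (m.-1 < (size q).+1)%N by lia.
  have := mmax (Ordinal m1) isT; rewrite /H /= -[X in _ <= rise (take X q)]prednK //.
  by rewrite rise_take_S // (negbTE nup) /=; lia.
have dn : ~~ nth false q m.
  apply/negP => up'.
  have := mmax (Ordinal (mq : (m.+1 < (size q).+1)%N)) isT; rewrite /H /=.
  by rewrite rise_take_S // up' /=; lia.
have /implyP/(_ _) := pk (Ordinal m1q).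
rewrite /peak /peak_height /= prednK // hw ?(ltnW mq) // !nw // up dn.
rewrite (leq_ltn_trans _ sw) ?(ltnW mq) // => /(_ isT).
by move: mgt; rewrite /H; lia.
Qed.

Lemma stays_and (P Q : pred int) (y : int) (w : seq bool) :
  stays P y w && stays Q y w = stays (fun z => P z && Q z) y w.
Proof.
elim: w y => [|b w IH] y /=; first by rewrite !andbT.
by rewrite -IH andbACA.
Qed.

(** The two steps of the peak return to the level of [q], so the conditions on [q] and [r] separate
    and communicate only through [rise q]. *)
Lemma dyck_weak_lr_max_cat (q r : seq bool) :
  dyck_word (q ++ true :: false :: r) &&
    weak_lr_max (q ++ true :: false :: r) (size q) =
  stays (fun y => 0 <= y <= rise q + 1) 0 q &&
    (stays (fun y => 0 <= y) (rise q) r && (rise q + rise r == 0)).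
Proof.
rewrite /dyck_word stays_cat -stays_and /= add0r.
case: (boolP (stays _ 0 q)) => [q0|] //=.
have rq0 : 0 <= rise q.
  by move: q0 => /staysP /(_ _ (leqnn _)); rewrite take_size add0r.
rewrite weak_lr_max_cat // rise_cat !rise_cons /= rq0 addrK.
have -> : 0 <= rise q + 1 by lia.
rewrite /= [1 + _](_ : _ = rise r); last by lia.
by rewrite andbC.
Qed.

Lemma sum_weak_lr_max (n : nat) :
  (\sum_(p in Dyck n) num_weak_lr_max p)%N%:R =
  \sum_(0 <= i < n.*2)
    wsum n.*2 (fun w => (dyck_word w && weak_lr_max w i)%:R).
Proof.
rewrite natr_sum big_mkcond /=.
rewrite -wsum_sum -wsum_tuple; apply: eq_bigr => p _.
rewrite mem_Dyck /num_weak_lr_max size_tuple; case: (dyck_word p) => /=; last first.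
  by rewrite big1.
rewrite -sum1_count big_mkcond natr_sum /= /index_iota subn0.
by apply: eq_bigr => i _; case: (weak_lr_max p i).
Qed.

(** The letters at positions [i] and [i.+1] must be up and down; [d] is the level of the prefix
    before them, so the peak has height [d.+1]. For a given prefix only one [d] contributes. *)
Lemma wsum_dyck_weak_lr_max (L i : nat) : (i <= L)%N ->
  wsum L.+2 (fun w => (dyck_word w && weak_lr_max w i)%:R) =
  \sum_(0 <= d < L.+1)
     num_paths (fun y => 0 <= y <= d.+1%:Z) 0 (d.+1%:Z - 1) i
     * nonneg_paths (L - i) d.
Proof.
move=> iL; rewrite (_ : L.+2 = (i + (2 + (L - i)))%N); last lia.
rewrite wsum_cat.
under [RHS]eq_bigr do rewrite mulrC /num_paths -wsumZ.
rewrite -wsum_sum; apply: eq_wsum => q qi.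
have vanish b c (r : seq bool) : ~~ (b && ~~ c) ->
    (dyck_word (q ++ b :: c :: r) && weak_lr_max (q ++ b :: c :: r) i)%:R = 0 :> int.
  have sqF : ((size q).+1 < size q)%N = false by lia.
  move=> bc; rewrite /weak_lr_max /peak -qi !nth_cat ltnn subnn sqF subSnn /=.
  by move: bc => /negbTE ->; rewrite andbF /= andbF.
rewrite /= (@eq_wsum _ (fun w => (dyck_word (q ++ true :: true :: w) && _)%:R) (fun=> 0));
  last by move=> w _; apply: vanish.
rewrite (@eq_wsum _ (fun w => (dyck_word (q ++ false :: true :: w) && _)%:R) (fun=> 0));
  last by move=> w _; apply: vanish.
rewrite (@eq_wsum _ (fun w => (dyck_word (q ++ false :: false :: w) && _)%:R) (fun=> 0));
  last by move=> w _; apply: vanish.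
rewrite wsum0 !addr0 add0r.
rewrite (@eq_wsum _ _ (fun r => (stays (fun y => 0 <= y <= rise q + 1) 0 q &&
    (stays (fun y => 0 <= y) (rise q) r && (rise q + rise r == 0)))%:R)); last first.
  by move=> r _; rewrite -qi dyck_weak_lr_max_cat.
rewrite add0n.
have rq := rise_count q; have cq := count_size (pred1 true) q.
case: (ltrP (rise q) 0) => rq0.
  rewrite big1 => [|d _]; last by rewrite add0r (_ : _ == _ = false) ?andbF ?mulr0 //; lia.
  rewrite -[RHS](wsum0 (L - i)); apply: eq_wsum => r _.
  case: (boolP (stays _ 0 q)) => [/staysP /(_ _ (leqnn _))|//].
  by rewrite take_size add0r; lia.
have rqE : (`|rise q|%N%:Z = rise q) by rewrite gez0_abs.
rewrite (bigD1_seq `|rise q|%N) ?iota_uniq //=; last first.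
  have cq' : (count_mem true q <= i)%N by rewrite -qi count_size.
  rewrite mem_index_iota /=; move: rqE rq cq' iL.
  move: (count_mem true q) (count_mem false q) `|rise q|%N (rise q) => c c' x y.
  clear; lia.
rewrite [X in _ = _ + X]big1 ?addr0 => [|d dq]; last first.
  by rewrite add0r (_ : (_ == _) = false) ?andbF ?mulr0 //; lia.
rewrite add0r (_ : (_ == _) = true) ?andbT; last by lia.
rewrite mulrC /nonneg_paths /num_paths -wsumZ; apply: eq_wsum => r _.
rewrite rqE [`|rise q|%N.+1%:Z](_ : _ = rise q + 1); last lia.
by case: (stays _ 0 q); rewrite ?mul0r ?mul1r.
Qed.

(** [walk_last_visit_abs] turns the convolution of each image into one value of [walk n.*2.+1]. The
    images of index j and -(j + 1) together give four consecutive odd arguments with signs +, -, -,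
    +, which is a second difference in the row of [n.+1]. *)
Lemma sum_refl_terms (n d K : nat) : (n.*2.+2 <= K)%N ->
  \sum_(i < n.*2.+1)
     num_paths (fun y => 0 <= y <= d.+1%:Z) 0 (d.+1%:Z - 1) i
     * nonneg_paths (n.*2 - i) d =
  \sum_(0 <= j < K) cdiff2 n.+1 (j.+1%:Z * d.+3%:Z - 1).
Proof.
move=> nK.
pose W (e : int) := walk n.*2.+1 (`|e| + d%:Z + 1).
pose G (k : int) := W (d%:Z + k * d.+3%:Z *+ 2) - W (d%:Z + 2 + k * d.+3%:Z *+ 2).
transitivity (\sum_(0 <= k < K.*2.+1) G (k%:Z - K%:Z)).
  under eq_bigr => i _.
    rewrite (@strip_paths_reflection d.+1 K i 0) //; last by have := ltn_ord i; lia.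
    rewrite mulr_suml.
    over.
  rewrite exchange_big /=; apply: eq_bigr => k _.
  rewrite /G /W -!walk_last_visit_abs -sumrB; apply: eq_bigr => i _.
  rewrite /refl_term mulrBl subr0 addr0.
  by congr (walk _ _ * _ - walk _ _ * _); lia.
have neg : \sum_(0 <= k < K) G (k%:Z - K%:Z) = \sum_(0 <= j < K) G (- j.+1%:Z).
  by rewrite big_nat_rev; apply: eq_big_nat => j jK; congr (G _); lia.
(* The image of index [K] has no partner, but it is out of reach. *)
have pos : \sum_(K <= k < K.*2.+1) G (k%:Z - K%:Z) = \sum_(0 <= j < K) G j%:Z.
  rewrite -{1}[K]add0n big_addn [(_ - K)%N](_ : _ = K.+1); last by lia.
  rewrite big_nat_recr //= [X in _ + X](_ : _ = 0) ?addr0; last first.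
    by rewrite /G /W !walk_out ?subrr //; nia.
  by apply: eq_bigr => j _; congr (G _); lia.
rewrite (@big_cat_nat _ _ _ K) //=; last by lia.
rewrite neg pos -big_split /=; apply: eq_bigr => j _.
(* Replacing the product by [t] makes every walk argument linear. *)
have [t [td tE]] : exists t : nat, (d <= t)%N /\ (j.+1%:Z * d.+3%:Z = t.+3%:Z).
  by exists (j * d.+3 + d)%N; lia.
have tE' : j%:Z * d.+3%:Z = t%:Z - d%:Z by move: tE; lia.
rewrite /G /W /cdiff2 /cwalk !mulNr tE tE' doubleS.
pose w (e : nat) := walk n.*2.+1 e%:Z.
have wE (e : int) (e' : nat) : e = e'%:Z -> walk n.*2.+1 e = w e' by move=> ->.
have cE (e : int) (e' : nat) : e = e'%:Z -> 
    walk n.*2.+2 (e *+ 2) = w (e'.*2.-1)%N + w (e'.*2.+1)%N \/ e' = 0%N.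
  move=> ->; case: e' => [|e']; [by right|left].
  transitivity (walk n.*2.+1 (e'.+1%:Z *+ 2 - 1) + walk n.*2.+1 (e'.+1%:Z *+ 2 + 1)).
    by [].
  by rewrite (wE _ (e'.+1.*2.-1)%N) ?(wE _ (e'.+1.*2.+1)%N) //; lia.
rewrite (wE _ (t.*2 + 7)%N); last by lia.
rewrite (wE _ (t.*2 + 5)%N); last by lia.
rewrite (wE _ (t.*2 + 1)%N); last by lia.
rewrite (wE _ (t.*2 + 3)%N); last by lia.
have [->|//] := cE (t.+3%:Z - 1 + 1) t.+3 ltac:(lia).
have [->|//] := cE (t.+3%:Z - 1) t.+2 ltac:(lia).
have [->|//] := cE (t.+3%:Z - 1 - 1) t.+1 ltac:(lia).
rewrite (_ : t.+3.*2.-1 = t.*2 + 5)%N; last by lia.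
rewrite (_ : t.+3.*2.+1 = t.*2 + 7)%N; last by lia.
rewrite (_ : t.+2.*2.-1 = t.*2 + 3)%N; last by lia.
rewrite (_ : t.+2.*2.+1 = t.*2 + 5)%N; last by lia.
rewrite (_ : t.+1.*2.-1 = t.*2 + 1)%N; last by lia.
rewrite (_ : t.+1.*2.+1 = t.*2 + 3)%N; last by lia.
by lia.
Qed.

Lemma sum_weak_lr_max_cdiff2 (n K : nat) : (n.*2.+2 <= K)%N ->
  (\sum_(p in Dyck n.+1) num_weak_lr_max p)%N%:R =
  \sum_(0 <= d < n.*2.+1) \sum_(0 <= j < K)
    cdiff2 n.+1 (j.+1%:Z * d.+3%:Z - 1).
Proof.
move=> nK; rewrite sum_weak_lr_max doubleS.
have last0 : wsum n.*2.+2
    (fun w => (dyck_word w && weak_lr_max w n.*2.+1)%:R) = 0.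
  rewrite -[RHS](wsum0 n.*2.+2); apply: eq_wsum => w sw.
  by rewrite /weak_lr_max /peak sw ltnn /= andbF.
rewrite big_nat_recr // last0 [LHS]addr0.
rewrite (eq_big_nat _ _ (F2 := fun i => \sum_(0 <= d < n.*2.+1)
     num_paths (fun y => 0 <= y <= d.+1%:Z) 0 (d.+1%:Z - 1) i
     * nonneg_paths (n.*2 - i) d)); last first.
  by move=> i ni; apply: wsum_dyck_weak_lr_max; lia.
rewrite exchange_big /=; apply: eq_bigr => d _.
by rewrite -sum_refl_terms // big_mkord.
Qed.

(** * The divisor function against its harmonic model *)

Lemma bin2R (R : realType) (m : nat) : 'C(m, 2)%:R = m%:R * (m%:R - 1) / 2 :> R.
Proof.
elim: m => [|m IH]; first by rewrite bin0n !mul0r.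
by rewrite binS natrD IH bin1 -natr1; field.
Qed.

Lemma bin3R (R : realType) (m : nat) :
  'C(m, 3)%:R = m%:R * (m%:R - 1) * (m%:R - 2) / 6 :> R.
Proof.
elim: m => [|m IH]; first by rewrite bin0n !mul0r.
by rewrite binS natrD IH bin2R -natr1; field.
Qed.

Lemma bin4R (R : realType) (m : nat) :
  'C(m, 4)%:R = m%:R * (m%:R - 1) * (m%:R - 2) * (m%:R - 3) / 24 :> R.
Proof.
elim: m => [|m IH]; first by rewrite bin0n !mul0r.
by rewrite binS natrD IH bin3R -natr1; field.
Qed.

(** Summing against ['C(X - N, k)] iterates summation k + 1 times; Pascal's rule is the recurrence
    in [X] behind the closed forms that follow. *)
Lemma big_nat_bin_convol_S (R : realType) (f : nat -> R) (k X : nat) :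
  \sum_(1 <= N < X.+2) f N * 'C(X.+1 - N, k.+1)%:R =
  \sum_(1 <= N < X.+1) f N * 'C(X - N, k.+1)%:R +
  \sum_(1 <= N < X.+1) f N * 'C(X - N, k)%:R.
Proof.
rewrite big_nat_recr //= subnn bin0n mulr0 addr0 -big_split /=.
apply: eq_big_nat => N /andP[_ NX].
by rewrite subSn // binS natrD mulrDr.
Qed.

Lemma mul_bin_invS (R : realType) (X k : nat) :
  'C(X.+1, k.+1)%:R * X.+1%:R^-1 = 'C(X, k)%:R * k.+1%:R^-1 :> R.
Proof.
have h := congr1 (fun n => n%:R : R) (mul_bin_diag X.+1 k); rewrite /= !natrM in h.
apply/eqP; rewrite eqr_div ?pnatr_eq0 //; apply/eqP.
by rewrite mulrC -h mulrC.
Qed.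

Lemma sum_inv_bin (R : realType) (X k : nat) :
  \sum_(1 <= N < X.+1) N%:R^-1 * 'C(X - N, k)%:R =
  'C(X, k)%:R * (harm R X - harm R k).
Proof.
elim: X k => [|X IH] k.
  rewrite big_geq //; case: k => [|k]; first by rewrite subrr mulr0.
  by rewrite bin0n mul0r.
case: k => [|k].
  rewrite bin0 mul1r harm0 subr0 /harm; apply: eq_bigr => N _.
  by rewrite bin0 mulr1.
rewrite big_nat_bin_convol_S !IH [in RHS]binS natrD !harmS.
have := mul_bin_invS R X k; rewrite binS natrD.
move: (X.+1%:R^-1) (k.+1%:R^-1) ('C(X, k.+1)%:R) ('C(X, k)%:R) => x y a b h.
move: (harm R X) (harm R k) => HX Hk.
rewrite [RHS](_ : _ = (a + b) * x + (a + b) * (HX - (Hk + y))); last by ring.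
by rewrite h; ring.
Qed.

Lemma sum_harm_bin (R : realType) (X k : nat) :
  \sum_(1 <= N < X.+1) harm R N * 'C(X - N, k)%:R =
  'C(X.+1, k.+1)%:R * (harm R X.+1 - harm R k.+1).
Proof.
elim: k X => [|k IH] X.
  elim: X => [|X IHX]; first by rewrite big_geq // subrr mulr0.
  rewrite big_nat_recr //= bin0 mulr1.
  transitivity (\sum_(1 <= N < X.+1) harm R N * 'C(X - N, 0)%:R + harm R X.+1).
    by congr (_ + _); apply: eq_bigr => N _; rewrite !bin0.
  rewrite IHX !bin1 [harm R X.+2]harmS [X.+2%:R]mulrSr.
  have X0 : X.+1%:R + 1 != 0 :> R by rewrite natr1 pnatr_eq0.
  rewrite [harm R 1]harmS harm0 add0r invr1.
  by move: (X.+1%:R : R) X0 (harm R X.+1) => x x0 a; field.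
elim: X => [|X IHX].
  rewrite big_geq //; case: k IH => [|k] _; last by rewrite bin_small // mul0r.
  by rewrite bin_small // mul0r.
rewrite big_nat_bin_convol_S IHX IH [in RHS]binS natrD [harm R X.+2]harmS [harm R k.+2]harmS.
have := mul_bin_invS R X.+1 k.+1; rewrite binS natrD.
move: (X.+2%:R^-1) (k.+2%:R^-1) ('C(X.+1, k.+2)%:R) ('C(X.+1, k.+1)%:R) => x y a b h.
move: (harm R X.+1) (harm R k.+1) => HX Hk.
rewrite [RHS](_ : _ = (a + b) * x + (a + b) * (HX - (Hk + y))); last by ring.
by rewrite h; ring.
Qed.

Lemma sum_const_bin (R : realType) (X k : nat) :
  \sum_(1 <= N < X.+1) 'C(X - N, k)%:R = 'C(X, k.+1)%:R :> R.
Proof.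
elim: X k => [|X IH] k; first by rewrite big_geq // bin0n.
case: k => [|k].
  rewrite bin1 (eq_bigr (fun=> 1)) ?sumr_const_nat ?subn1 // => N _.
  by rewrite bin0.
have := @big_nat_bin_convol_S R (fun=> 1) k X.
under eq_bigr do rewrite mul1r; move=> ->.
under eq_bigr do rewrite mul1r; rewrite IH.
under eq_bigr do rewrite mul1r; rewrite IH.
by rewrite -natrD -binS.
Qed.

Lemma sum_invS_bin (R : realType) (X k : nat) :
  \sum_(1 <= N < X.+1) N.+1%:R^-1 * 'C(X - N, k)%:R =
  'C(X.+1, k)%:R * (harm R X.+1 - harm R k) - 'C(X, k)%:R.
Proof.
rewrite -sum_inv_bin [in RHS]big_ltn // invr1 mul1r subn1 /= addrC addKr.
by rewrite [RHS]big_add1 /=; apply: eq_bigr => N _; rewrite subSS.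
Qed.

(* The main part is ln N + 2 gamma; the terms in 1/12 and the mass at N = 1 are
   the corrections making its sums against 'C(X.+1 - N, 3) agree with those of
   the divisor function up to O(X^2).  That kernel is (y^3 - y)/6 at y = X - N,
   and truncated subtraction makes it vanish for N > X. *)
Definition div_model (R : realType) (N : nat) : R :=
  harm R N - N%:R^-1 / 2 + euler_gamma R + (N%:R^-1 - N.+1%:R^-1) / 12
  + (N == 1)%:R * (euler_gamma R / 2 - 3^-1).

Lemma sum_div_model_bin (R : realType) (X : nat) : (0 < X)%N ->
  \sum_(1 <= N < X.+2) div_model R N * 'C(X.+1 - N, 3)%:R =
  (X%:R ^+ 4 - 2 * X%:R ^+ 2 - X%:R) / 24 * harm R X
  + ((X%:R + 2) * X%:R * (X%:R - 1) / 24 + (X%:R + 1) * X%:R * (X%:R - 1) / 24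
     - (X%:R + 2) * (X%:R + 1) * X%:R * (X%:R - 1) / 24 * (25 / 12)
     - 5 / 12 * (X%:R * (X%:R - 1) / 6
                 - (X%:R + 1) * X%:R * (X%:R - 1) / 6 * (11 / 6))
     + euler_gamma R * ((X%:R + 1) * X%:R * (X%:R - 1) * (X%:R - 2) / 24)
     - 12^-1 * ((X%:R + 2) * X%:R / 6 + (X%:R + 1) * X%:R / 6
                - (X%:R + 2) * (X%:R + 1) * X%:R / 6 * (11 / 6)
                - (X%:R + 1) * X%:R * (X%:R - 1) / 6)
     + (euler_gamma R / 2 - 3^-1) * (X%:R * (X%:R - 1) * (X%:R - 2) / 6)).
Proof.
move=> X0; set g := euler_gamma R.
transitivity (
   \sum_(1 <= N < X.+2) harm R N * 'C(X.+1 - N, 3)%:R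
 + (12^-1 - 2^-1) * \sum_(1 <= N < X.+2) N%:R^-1 * 'C(X.+1 - N, 3)%:R
 + g * \sum_(1 <= N < X.+2) 'C(X.+1 - N, 3)%:R
 - 12^-1 * \sum_(1 <= N < X.+2) N.+1%:R^-1 * 'C(X.+1 - N, 3)%:R
 + (g / 2 - 3^-1) * 'C(X, 3)%:R).
  rewrite [X in _ = _ + X](_ : _ =
     \sum_(1 <= N < X.+2) (N == 1)%:R * (g / 2 - 3^-1) * 'C(X.+1 - N, 3)%:R); last first.
    rewrite big_ltn //= mul1r subSS subn0 big_nat_cond big1 ?addr0 //.
    by move=> [|[|N]] //= _; rewrite !mul0r.
  rewrite !mulr_sumr -!big_split -sumrN -!big_split /=; apply: eq_bigr => N _.
  by rewrite /div_model -/g; move: (N%:R^-1) (N.+1%:R^-1) => a b; ring.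
rewrite sum_harm_bin sum_inv_bin sum_const_bin sum_invS_bin.
have h3 : harm R 3 = 11 / 6 by rewrite !harmS harm0; field.
have h4 : harm R 4 = 25 / 12 by rewrite !harmS harm0; field.
rewrite h3 h4 (harmS R X.+1) (harmS R X) !bin3R !bin4R.
have e1 : X.+1%:R = X%:R + 1 :> R by rewrite natr1.
have e2 : X.+2%:R = X%:R + 1 + 1 :> R by rewrite !natr1.
rewrite e2 e1.
have x0 : X%:R + 1 != 0 :> R by rewrite natr1 pnatr_eq0.
have x1 : X%:R + 1 + 1 != 0 :> R by rewrite !natr1 pnatr_eq0.
move: (X%:R : R) x0 x1 (harm R X) => x x0 x1 H.
by field; rewrite x0 x1.
Qed.

(** With [v] the inverse of [A] and [t] at most [2 * A], the monomial is at most [2 ^+ i] times A to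
    the power i + j - k. *)
Lemma monomial_le (R : realType) (A v t : R) (i k j : nat) :
  A * v = 1 -> 1 <= A -> 0 <= v -> 0 <= t -> t <= 2 * A -> (i + j <= 4 + k)%N ->
  `|t ^+ i * v ^+ k * A ^+ j| <= 2 ^+ i * A ^+ 4.
Proof.
move=> Av A1 v0 t0 tA ijk; have A0 : 0 <= A by lra.
rewrite ger0_norm ?mulr_ge0 ?exprn_ge0//.
apply: (@le_trans _ _ ((2 * A) ^+ i * v ^+ k * A ^+ j)).
  by rewrite !ler_wpM2r ?exprn_ge0// lerXn2r// nnegrE; lra.
rewrite exprMn -!mulrA ler_wpM2l ?exprn_ge0//.
rewrite mulrCA -exprD -[leRHS]mul1r -[X in X * A ^+ 4](expr1n _ k) -Av exprMn.
rewrite mulrAC -exprD [leRHS]mulrC ler_wpM2l ?exprn_ge0//.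
by rewrite ler_weXn2l// (addnC k).
Qed.

(* What remains of the closed form of the hyperbola sum minus that of the model
   at X = A^2 + t, v = 1/A, l = ln A, g = gamma: each
   monomial t^i v^k A^j has i + j <= 4 + k. *)
Definition hyperbola_remainder (R : realType) (A v t g l : R) : R :=
   5 / 24 * (g * (t ^+ 0 * v ^+ 0 * A ^+ 4))
   + 5 / 12 * (g * (t ^+ 1 * v ^+ 0 * A ^+ 2))
   + 5 / 24 * (g * (t ^+ 2 * v ^+ 0 * A ^+ 0))
   + 1 / 12 * (l * (t ^+ 0 * v ^+ 0 * A ^+ 2))
   - 5 / 24 * (g * (t ^+ 0 * v ^+ 0 * A ^+ 2))
   + 1 / 12 * (l * (t ^+ 1 * v ^+ 0 * A ^+ 0))
   - 5 / 24 * (g * (t ^+ 1 * v ^+ 0 * A ^+ 0))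
   + 1 / 24 * (t ^+ 4 * v ^+ 1 * A ^+ 0)
   - 1 / 12 * (t ^+ 2 * v ^+ 1 * A ^+ 0)
   - 5 / 72 * (t ^+ 3 * v ^+ 0 * A ^+ 0)
   - 1 / 144 * (t ^+ 4 * v ^+ 2 * A ^+ 0)
   + 5 / 36 * (t ^+ 0 * v ^+ 0 * A ^+ 2)
   + 17 / 72 * (t ^+ 1 * v ^+ 0 * A ^+ 0)
   + 5 / 144 * (t ^+ 2 * v ^+ 2 * A ^+ 0)
   - 11 / 72 * (t ^+ 0 * v ^+ 0 * A ^+ 4)
   - 5 / 16 * (t ^+ 1 * v ^+ 0 * A ^+ 2)
   + 1 / 24 * (t ^+ 2 * v ^+ 0 * A ^+ 1)
   - 1 / 96 * (t ^+ 4 * v ^+ 0 * A ^+ 0)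
   - 1 / 24 * (t ^+ 5 * v ^+ 2 * A ^+ 0)
   - 5 / 144 * (t ^+ 6 * v ^+ 4 * A ^+ 0)
   - 43 / 288 * (t ^+ 2 * v ^+ 0 * A ^+ 0)
   + 1 / 36 * (t ^+ 3 * v ^+ 2 * A ^+ 0)
   + 1 / 72 * (t ^+ 4 * v ^+ 4 * A ^+ 0)
   - 1 / 72 * (t ^+ 7 * v ^+ 6 * A ^+ 0)
   + 1 / 36 * (t ^+ 5 * v ^+ 6 * A ^+ 0)
   - 1 / 144 * (t ^+ 3 * v ^+ 4 * A ^+ 0)
   + 1 / 72 * (t ^+ 4 * v ^+ 6 * A ^+ 0)
   + 1 / 48 * (t ^+ 0 * v ^+ 0 * A ^+ 0).

(** Each monomial is bounded separately, a factor [g] costing 2 and a factor [l] one power of [A];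
    it is then abstracted, so that only linear arithmetic remains. The absolute coefficients
    weighted by these bounds add up to less than 17. *)
Lemma hyperbola_remainder_le (R : realType) (A v t g l : R) :
  A * v = 1 -> 1 <= A -> 0 <= t <= 2 * A -> `|g| <= 2 -> 0 <= l <= A ->
  `|hyperbola_remainder R A v t g l| <= 17 * A ^+ 4.
Proof.
move=> Av A1 /andP[t0 tA] g2 /andP[l0 lA].
have A40 : 0 <= A ^+ 4 by rewrite exprn_ge0//; lra.
have v0 : 0 <= v by rewrite -(@pmulr_rge0 _ A) ?Av//; lra.
have mono (i k j : nat) : (i + j <= 4 + k)%N ->
    `|t ^+ i * v ^+ k * A ^+ j| <= 2 ^+ i * A ^+ 4.
  exact: monomial_le.
have monog (i k j : nat) : (i + j <= 4 + k)%N ->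
    `|g * (t ^+ i * v ^+ k * A ^+ j)| <= 2 * 2 ^+ i * A ^+ 4.
  by move=> /mono h; rewrite normrM -[leRHS]mulrA ler_pM.
have monol (i k j : nat) : (i + j.+1 <= 4 + k)%N ->
    `|l * (t ^+ i * v ^+ k * A ^+ j)| <= 2 ^+ i * A ^+ 4.
  move=> /mono; apply: le_trans.
  have -> : t ^+ i * v ^+ k * A ^+ j.+1 = A * (t ^+ i * v ^+ k * A ^+ j).
    by rewrite exprS mulrCA.
  rewrite normrM [leRHS]normrM; apply: ler_wpM2r => //.
  by rewrite !ger0_norm//; lra.
have p0 : 2 ^+ 0 = 1 :> R by ring.
have p1 : 2 ^+ 1 = 2 :> R by ring.
have p2 : 2 ^+ 2 = 4 :> R by ring.
have p3 : 2 ^+ 3 = 8 :> R by ring.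
have p4 : 2 ^+ 4 = 16 :> R by ring.
have p5 : 2 ^+ 5 = 32 :> R by ring.
have p6 : 2 ^+ 6 = 64 :> R by ring.
have p7 : 2 ^+ 7 = 128 :> R by ring.
have h0 := monog 0%N 0%N 4%N isT; rewrite p0 in h0.
have h1 := monog 1%N 0%N 2%N isT; rewrite p1 in h1.
have h2 := monog 2%N 0%N 0%N isT; rewrite p2 in h2.
have h3 := monol 0%N 0%N 2%N isT; rewrite p0 in h3.
have h4 := monog 0%N 0%N 2%N isT; rewrite p0 in h4.
have h5 := monol 1%N 0%N 0%N isT; rewrite p1 in h5.
have h6 := monog 1%N 0%N 0%N isT; rewrite p1 in h6.
have h7 := mono 4%N 1%N 0%N isT; rewrite p4 in h7.
have h8 := mono 2%N 1%N 0%N isT; rewrite p2 in h8.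
have h9 := mono 3%N 0%N 0%N isT; rewrite p3 in h9.
have h10 := mono 4%N 2%N 0%N isT; rewrite p4 in h10.
have h11 := mono 0%N 0%N 2%N isT; rewrite p0 in h11.
have h12 := mono 1%N 0%N 0%N isT; rewrite p1 in h12.
have h13 := mono 2%N 2%N 0%N isT; rewrite p2 in h13.
have h14 := mono 0%N 0%N 4%N isT; rewrite p0 in h14.
have h15 := mono 1%N 0%N 2%N isT; rewrite p1 in h15.
have h16 := mono 2%N 0%N 1%N isT; rewrite p2 in h16.
have h17 := mono 4%N 0%N 0%N isT; rewrite p4 in h17.
have h18 := mono 5%N 2%N 0%N isT; rewrite p5 in h18.
have h19 := mono 6%N 4%N 0%N isT; rewrite p6 in h19.
have h20 := mono 2%N 0%N 0%N isT; rewrite p2 in h20.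
have h21 := mono 3%N 2%N 0%N isT; rewrite p3 in h21.
have h22 := mono 4%N 4%N 0%N isT; rewrite p4 in h22.
have h23 := mono 7%N 6%N 0%N isT; rewrite p7 in h23.
have h24 := mono 5%N 6%N 0%N isT; rewrite p5 in h24.
have h25 := mono 3%N 4%N 0%N isT; rewrite p3 in h25.
have h26 := mono 4%N 6%N 0%N isT; rewrite p4 in h26.
have h27 := mono 0%N 0%N 0%N isT; rewrite p0 in h27.
rewrite /hyperbola_remainder.
move: (g * (t ^+ 0 * v ^+ 0 * A ^+ 4)) h0 => x0; rewrite ler_norml => /andP[].
move: (g * (t ^+ 1 * v ^+ 0 * A ^+ 2)) h1 => x1; rewrite ler_norml => /andP[].
move: (g * (t ^+ 2 * v ^+ 0 * A ^+ 0)) h2 => x2; rewrite ler_norml => /andP[].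
move: (l * (t ^+ 0 * v ^+ 0 * A ^+ 2)) h3 => x3; rewrite ler_norml => /andP[].
move: (g * (t ^+ 0 * v ^+ 0 * A ^+ 2)) h4 => x4; rewrite ler_norml => /andP[].
move: (l * (t ^+ 1 * v ^+ 0 * A ^+ 0)) h5 => x5; rewrite ler_norml => /andP[].
move: (g * (t ^+ 1 * v ^+ 0 * A ^+ 0)) h6 => x6; rewrite ler_norml => /andP[].
move: (t ^+ 4 * v ^+ 1 * A ^+ 0) h7 => x7; rewrite ler_norml => /andP[].
move: (t ^+ 2 * v ^+ 1 * A ^+ 0) h8 => x8; rewrite ler_norml => /andP[].
move: (t ^+ 3 * v ^+ 0 * A ^+ 0) h9 => x9; rewrite ler_norml => /andP[].
move: (t ^+ 4 * v ^+ 2 * A ^+ 0) h10 => x10; rewrite ler_norml => /andP[].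
move: (t ^+ 0 * v ^+ 0 * A ^+ 2) h11 => x11; rewrite ler_norml => /andP[].
move: (t ^+ 1 * v ^+ 0 * A ^+ 0) h12 => x12; rewrite ler_norml => /andP[].
move: (t ^+ 2 * v ^+ 2 * A ^+ 0) h13 => x13; rewrite ler_norml => /andP[].
move: (t ^+ 0 * v ^+ 0 * A ^+ 4) h14 => x14; rewrite ler_norml => /andP[].
move: (t ^+ 1 * v ^+ 0 * A ^+ 2) h15 => x15; rewrite ler_norml => /andP[].
move: (t ^+ 2 * v ^+ 0 * A ^+ 1) h16 => x16; rewrite ler_norml => /andP[].
move: (t ^+ 4 * v ^+ 0 * A ^+ 0) h17 => x17; rewrite ler_norml => /andP[].
move: (t ^+ 5 * v ^+ 2 * A ^+ 0) h18 => x18; rewrite ler_norml => /andP[].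
move: (t ^+ 6 * v ^+ 4 * A ^+ 0) h19 => x19; rewrite ler_norml => /andP[].
move: (t ^+ 2 * v ^+ 0 * A ^+ 0) h20 => x20; rewrite ler_norml => /andP[].
move: (t ^+ 3 * v ^+ 2 * A ^+ 0) h21 => x21; rewrite ler_norml => /andP[].
move: (t ^+ 4 * v ^+ 4 * A ^+ 0) h22 => x22; rewrite ler_norml => /andP[].
move: (t ^+ 7 * v ^+ 6 * A ^+ 0) h23 => x23; rewrite ler_norml => /andP[].
move: (t ^+ 5 * v ^+ 6 * A ^+ 0) h24 => x24; rewrite ler_norml => /andP[].
move: (t ^+ 3 * v ^+ 4 * A ^+ 0) h25 => x25; rewrite ler_norml => /andP[].
move: (t ^+ 4 * v ^+ 6 * A ^+ 0) h26 => x26; rewrite ler_norml => /andP[].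
move: (t ^+ 0 * v ^+ 0 * A ^+ 0) h27 => x27; rewrite ler_norml => /andP[].
clear mono monog monol p0 p1 p2 p3 p4 p5 p6 p7 Av; move: (A ^+ 4) A40 => a4 A40.
move=> lo0 up0 lo1 up1 lo2 up2 lo3 up3 lo4 up4 lo5 up5 lo6 up6 lo7 up7 lo8 up8 lo9 up9 lo10 up10 lo11 up11 lo12 up12 lo13 up13 lo14 up14 lo15 up15 lo16 up16 lo17 up17 lo18 up18 lo19 up19 lo20 up20 lo21 up21 lo22 up22 lo23 up23 lo24 up24 lo25 up25 lo26 up26 lo27 up27.
by rewrite ler_norml; apply/andP; split; lra.
Qed.

(* quad a (y + a) - quad a y = k (y + a) + k y for the kernel k y = (y^3 - y)/6. *)
Definition quad (R : realType) (a y : R) : R :=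
  y ^+ 4 / (12 * a) + a * y ^+ 2 / 12 - y ^+ 2 / (6 * a).

Lemma bin3SR (R : realType) (m : nat) :
  'C(m.+1, 3)%:R = (m%:R ^+ 3 - m%:R) / 6 :> R.
Proof. by rewrite bin3R -natr1; field. Qed.

(** The left side is twice a trapezoidal sum along a row, which [quad] telescopes. The index [i]
    counts back from b = [X %/ a], the last b with [a * b <= X], where the kernel is taken at y =
    [X %% a]. *)
Lemma row_sum (R : realType) (a X B i : nat) : (0 < a)%N -> (X < B)%N ->
  (i <= X %/ a)%N ->
  2 * (\sum_((X %/ a - i).+1 <= b < B) 'C(X.+1 - a * b, 3)%:R)
    + 'C(X.+1 - a * (X %/ a - i), 3)%:R
  = quad R a%:R (X %% a + i * a)%N%:R - quad R a%:R (X %% a)%:R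
    + 'C((X %% a).+1, 3)%:R.
Proof.
move=> a0 XB; have an0 : a%:R != 0 :> R by rewrite pnatr_eq0 -lt0n.
have Xq := divn_eq X a; have rq := ltn_pmod X a0.
have val (j : nat) : (j <= X %/ a)%N ->
    (X.+1 - a * (X %/ a - j))%N = (X %% a + j * a).+1.
  move: Xq; move: (X %/ a)%N (X %% a)%N => q r -> jq.
  rewrite mulnBr -addSn; have : (a * j <= a * q)%N by rewrite leq_mul2l jq orbT.
  by rewrite [(q * a)%N]mulnC [(j * a)%N]mulnC; lia.
have qX : (X %/ a <= X)%N by exact: leq_div.
elim: i => [|i IH] iq.
  rewrite val // mul0n addn0 subrr add0r big_nat big1 ?mulr0 ?add0r // => b /andP[qb _].
  rewrite (_ : (X.+1 - a * b = 0)%N) ?bin0n //.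
  have : (a * (X %/ a).+1 <= a * b)%N by move: qb; rewrite subn0 leq_mul2l => ->; rewrite orbT.
  by move: Xq rq; rewrite mulnS; lia.
have iq' : (i <= X %/ a)%N by lia.
have split_first : \sum_((X %/ a - i.+1).+1 <= b < B) 'C(X.+1 - a * b, 3)%:R =
    'C(X.+1 - a * (X %/ a - i), 3)%:R
    + \sum_((X %/ a - i).+1 <= b < B) 'C(X.+1 - a * b, 3)%:R :> R.
  have -> : (X %/ a - i.+1).+1 = (X %/ a - i)%N.
    by move: iq; move: (X %/ a)%N => q; clear; lia.
  by rewrite big_ltn // (leq_ltn_trans _ XB) // (leq_trans (leq_subr _ _)).
have := IH iq'; rewrite split_first.
move=> H.
have regroup (f S f' : R) : 2 * (f + S) + f' = 2 * S + f + f + f' by ring.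
rewrite regroup H val // val // !bin3SR /quad mulSn !natrD !natrM.
move: (a%:R : R) an0 ((X %% a)%:R : R) (i%:R : R) => x x0 r y.
by field.
Qed.

Lemma quad_le (R : realType) (a r : R) : 1 <= a -> 0 <= r -> r <= a ->
  `|(r ^+ 3 - r) / 6 - quad R a r| <= a ^+ 3.
Proof.
move=> a1 r0 ra; have a0 : 0 < a by lra.
have r2 : r ^+ 2 <= a ^+ 2 by rewrite lerXn2r// nnegrE; lra.
have r3 : r ^+ 3 <= a ^+ 3 by rewrite lerXn2r// nnegrE; lra.
have r4 : r ^+ 4 / a <= a ^+ 3.
  by rewrite ler_pdivrMr// -exprSr lerXn2r// nnegrE; lra.
have r2a : r ^+ 2 / a <= a by rewrite ler_pdivrMr// -expr2.
have ar2 : a * r ^+ 2 <= a ^+ 3 by rewrite exprS ler_wpM2l// ltW.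
have a3 : a <= a ^+ 3 by rewrite -[leLHS]expr1 ler_weXn2l.
have p1 : 0 <= r ^+ 4 / a by rewrite divr_ge0 ?exprn_ge0// ltW.
have p2 : 0 <= r ^+ 2 / a by rewrite divr_ge0 ?exprn_ge0// ltW.
have p3 : 0 <= a * r ^+ 2 by rewrite mulr_ge0 ?exprn_ge0// ltW.
have p4 : 0 <= r ^+ 3 by rewrite exprn_ge0.
have -> : quad R a r = r ^+ 4 / a / 12 + a * r ^+ 2 / 12 - r ^+ 2 / a / 6.
  by rewrite /quad; field; rewrite gt_eqF.
move: (r ^+ 4 / a) (a * r ^+ 2) (r ^+ 2 / a) (r ^+ 3) (a ^+ 3) r3 r4 r2a ar2 a3 p1 p2 p3 p4.
by move=> *; rewrite ler_norml; apply/andP; split; lra.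
Qed.

(** Going back to b = a brings the argument of [quad] to X - a^2. The terms in [X %% a] are merely
    bounded: this is the whole loss of the hyperbola method. *)
Lemma row_sum_le (R : realType) (a X B : nat) : (0 < a)%N -> (X < B)%N ->
  (a * a <= X)%N ->
  `|2 * (\sum_(a.+1 <= b < B) 'C(X.+1 - a * b, 3)%:R) + 'C(X.+1 - a * a, 3)%:R
    - quad R a%:R (X%:R - a%:R ^+ 2)| <= a%:R ^+ 3.
Proof.
move=> a0 XB aX; have aq : (a <= X %/ a)%N by rewrite leq_divRL.
have := @row_sum R a X B (X %/ a - a) a0 XB (leq_subr _ _).
rewrite subKn // => ->.
have -> : (X %% a + (X %/ a - a) * a)%N%:R = X%:R - a%:R ^+ 2 :> R.
  rewrite {3}(divn_eq X a) mulnBl natrD natrB ?leq_mul2r ?aq ?orbT //.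
  by rewrite natrD !natrM; ring.
rewrite bin3SR [X in `|X|](_ : _ = ((X %% a)%:R ^+ 3 - (X %% a)%:R) / 6
  - quad R a%:R (X %% a)%:R); last by ring.
by apply: quad_le; rewrite ?ler1n ?ler0n ?ler_nat // ltnW // ltn_pmod.
Qed.

Lemma hyperbola_symmetry (R : realType) (f : nat -> R) (B : nat) :
  \sum_(1 <= a < B.+1) \sum_(1 <= b < B.+1) f (a * b)%N =
  \sum_(1 <= a < B.+1) (2 * (\sum_(a.+1 <= b < B.+1) f (a * b)%N) + f (a * a)%N).
Proof.
elim: B => [|B IH]; first by rewrite !big_geq.
rewrite [LHS]big_nat_recr //= [RHS]big_nat_recr //=.
rewrite [X in 2 * X + f (B.+1 * B.+1)%N]big_geq // mulr0 add0r.
rewrite [X in _ + X = _]big_nat_recr //= addrA; congr (_ + _).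
under eq_bigr do rewrite big_nat_recr //=.
rewrite big_split /= IH.
transitivity (\sum_(1 <= a < B.+1) ((2 * (\sum_(a.+1 <= b < B.+1) f (a * b)%N)
   + f (a * a)%N) + 2 * f (a * B.+1)%N)); last first.
  apply: eq_big_nat => a /andP[_ aB].
  by rewrite [in RHS]big_nat_recr //= mulrDr addrAC.
rewrite [RHS]big_split /= -addrA; congr (_ + _).
rewrite -mulr_sumr mulr_natl mulr2n; congr (_ + _).
by apply: eq_bigr => b _; rewrite mulnC.
Qed.

(** For [X <= B] this is the fourfold iterated sum of the divisor function, since the kernel
    vanishes for [a * b > X]. A cutoff independent of [X] lets summations be exchanged later. *)
Definition div_sum (R : realType) (B X : nat) : R :=
  \sum_(1 <= a < B.+1) \sum_(1 <= b < B.+1) 'C(X.+1 - a * b, 3)%:R.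

Lemma div_sum_le (R : realType) (B X A : nat) : (X <= B)%N ->
  (A * A <= X)%N -> (X < A.+1 * A.+1)%N ->
  `|div_sum R B X - \sum_(1 <= a < A.+1) quad R a%:R (X%:R - a%:R ^+ 2)|
  <= A%:R ^+ 4.
Proof.
move=> XB AX XA.
rewrite /div_sum (hyperbola_symmetry R (fun N => 'C(X.+1 - N, 3)%:R)).
have AB : (A <= B)%N by rewrite (leq_trans _ XB)// (leq_trans _ AX)//; nia.
rewrite (@big_cat_nat _ _ _ A.+1) //=.
(* Rows with [a > A] contain only products above [X], where the kernel is zero. *)
rewrite [X in _ + X - _]big_nat [X in _ + X - _]big1 ?addr0; last first.
  move=> a /andP[aA _]; rewrite (_ : X.+1 - a * a = 0)%N; last by nia.
  rewrite bin0n addr0 big_nat big1 ?mulr0 // => b /andP[ab _].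
  by rewrite (_ : X.+1 - a * b = 0)%N ?bin0n //; nia.
rewrite -sumrB (le_trans (ler_norm_sum _ _ _)) //.
apply: (@le_trans _ _ (\sum_(1 <= a < A.+1) A%:R ^+ 3)).
  rewrite !big_nat; apply: ler_sum => a /andP[a0 aA].
  apply: (le_trans (@row_sum_le R a X B.+1 a0 _ _)) => //; first by nia.
  by rewrite lerXn2r ?nnegrE ?ler0n // ler_nat.
by rewrite sumr_const_nat subn1 /= [A%:R ^+ 4]exprSr mulr_natr.
Qed.

(** Expanding [quad] gives only odd powers of [a]: [s1], [s3], [s5], [s7] are the sums of the powers
    1, 3, 5, 7 up to [A], and the power -1 gives the harmonic number. *)
Lemma sum_quad (R : realType) (A : nat) (x : R) :
  12 * \sum_(1 <= a < A.+1) quad R a%:R (x - a%:R ^+ 2) =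
  let y := A%:R in
  let s1 := y * (y + 1) / 2 in
  let s3 := s1 ^+ 2 in
  let s5 := y ^+ 2 * (y + 1) ^+ 2 * (2 * y ^+ 2 + 2 * y - 1) / 12 in
  let s7 := y ^+ 2 * (y + 1) ^+ 2
    * (3 * y ^+ 4 + 6 * y ^+ 3 - y ^+ 2 - 4 * y + 2) / 24 in
  harm R A * (x ^+ 4 - 2 * x ^+ 2)
  - 4 * x ^+ 3 * s1 + 6 * x ^+ 2 * s3 - 4 * x * s5 + s7
  + x ^+ 2 * s1 - 2 * x * s3 + s5 + 4 * x * s1 - 2 * s3.
Proof.
elim: A => [|A IH] /=; first by rewrite big_geq // harm0; field.
rewrite big_nat_recr //= mulrDr IH /= harmS /quad -[A.+1%:R]natr1.
have y1 : A%:R + 1 != 0 :> R by rewrite natr1 pnatr_eq0.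
by move: (A%:R : R) y1 (harm R A) => y y1 H; field.
Qed.

Lemma exists_sqrt (X : nat) : exists A, (A * A <= X)%N /\ (X < A.+1 * A.+1)%N.
Proof.
elim: X => [|X [A [AX XA]]]; first by exists 0%N.
have [XA'|XA'] := ltnP X.+1 (A.+1 * A.+1); first by exists A; split => //; lia.
by exists A.+1; split; nia.
Qed.

(** All terms of order above A^4 cancel, which is what fixes the constants of [div_model]. The
    logarithm of 1 + t/A^2 may be cut after its cubic term: the next one is of order A^(-4), hence
    A^4 once multiplied by X^4. [w] stands for 1/(2X), described by the only product in which it
    occurs. *)
Lemma model_identity (R : realType) (A t l g e1 e2 w X HA HX : R) : A != 0 ->
  X = A ^+ 2 + t ->
  w * (X ^+ 4 - 2 * X ^+ 2 - X) = (X ^+ 3 - 2 * X - 1) / 2 ->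
  HA = l + g + (2 * A)^-1 - (12 * A ^+ 2)^-1 + e1 ->
  HX = 2 * l + (t / A ^+ 2 - (t / A ^+ 2) ^+ 2 / 2 + (t / A ^+ 2) ^+ 3 / 3)
       + g + w + e2 ->
  let s1 := A * (A + 1) / 2 in
  let s3 := s1 ^+ 2 in
  let s5 := A ^+ 2 * (A + 1) ^+ 2 * (2 * A ^+ 2 + 2 * A - 1) / 12 in
  let s7 := A ^+ 2 * (A + 1) ^+ 2
    * (3 * A ^+ 4 + 6 * A ^+ 3 - A ^+ 2 - 4 * A + 2) / 24 in
  (HA * (X ^+ 4 - 2 * X ^+ 2)
  - 4 * X ^+ 3 * s1 + 6 * X ^+ 2 * s3 - 4 * X * s5 + s7
  + X ^+ 2 * s1 - 2 * X * s3 + s5 + 4 * X * s1 - 2 * s3) / 12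
  - ((X ^+ 4 - 2 * X ^+ 2 - X) / 24 * HX
  + ((X + 2) * X * (X - 1) / 24 + (X + 1) * X * (X - 1) / 24
     - (X + 2) * (X + 1) * X * (X - 1) / 24 * (25 / 12)
     - 5 / 12 * (X * (X - 1) / 6
                 - (X + 1) * X * (X - 1) / 6 * (11 / 6))
     + g * ((X + 1) * X * (X - 1) * (X - 2) / 24)
     - 12^-1 * ((X + 2) * X / 6 + (X + 1) * X / 6
                - (X + 2) * (X + 1) * X / 6 * (11 / 6)
                - (X + 1) * X * (X - 1) / 6)
     + (g / 2 - 3^-1) * (X * (X - 1) * (X - 2) / 6)))
  = hyperbola_remainder R A A^-1 t g l
    + e1 * (X ^+ 4 - 2 * X ^+ 2) / 12
    - (X ^+ 4 - 2 * X ^+ 2 - X) / 24 * e2.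
Proof.
move=> A0 XE wE -> -> s1 s3 s5 s7.
set lam := _ - _ + _ / 3.
have -> : (X ^+ 4 - 2 * X ^+ 2 - X) / 24 * (2 * l + lam + g + w + e2) =
    (X ^+ 4 - 2 * X ^+ 2 - X) / 24 * (2 * l + lam + g + e2)
    + (X ^+ 3 - 2 * X - 1) / 48.
  have -> : (X ^+ 3 - 2 * X - 1) / 48 = w * (X ^+ 4 - 2 * X ^+ 2 - X) / 24.
    by rewrite wE; field.
  by field.
rewrite /s7 /s5 /s3 /s1 /lam /hyperbola_remainder XE.
by field.
Qed.

Lemma euler_gamma_le2 (R : realType) : `|euler_gamma R| <= 2.
Proof.
have := harm_expansion R 1 isT.
rewrite /harm_err harmS harm0 !(ln1, expr1n, mulr1, invr1, add0r).
by rewrite !ler_norml => /andP[a b]; apply/andP; split; lra.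
Qed.

Lemma harm_le (R : realType) (n : nat) : (0 < n)%N ->
  `|harm R n - (ln n%:R + euler_gamma R + (2 * n%:R)^-1 - (12 * n%:R ^+ 2)^-1)|
  <= (n%:R ^+ 4)^-1.
Proof.
move=> n0; apply: le_trans (harm_expansion R n n0).
by rewrite /harm_err le_eqVlt; apply/orP; left; apply/eqP; congr `|_|; ring.
Qed.

Lemma div_sum_model_le (R : realType) (B X : nat) : (0 < X)%N -> (X <= B)%N ->
  `|div_sum R B X
    - \sum_(1 <= N < X.+2) div_model R N * 'C(X.+1 - N, 3)%:R| <= 30 * X%:R ^+ 2.
Proof.
move=> X0 XB; have [A [AX XA]] := exists_sqrt X.
have A0 : (0 < A)%N by nia.
have a1 : 1 <= A%:R :> R by rewrite ler1n.
have a0 : 0 < A%:R :> R by lra.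
have x1 : 1 <= X%:R :> R by rewrite ler1n.
pose t : R := X%:R - A%:R ^+ 2.
have t0 : 0 <= t by rewrite subr_ge0 -natrX ler_nat; lia.
have tA : t <= 2 * A%:R by rewrite lerBlDr -natrX -natrM -natrD ler_nat; lia.
have XE : X%:R = A%:R ^+ 2 + t by rewrite addrC subrK.
pose l : R := ln A%:R; pose g := euler_gamma R.
have l0 : 0 <= l by apply: ln_ge0.
have lA : l <= A%:R by apply/ltW/ln_sublinear.
pose e1 := harm R A - (l + g + (2 * A%:R)^-1 - (12 * A%:R ^+ 2)^-1).
have e1E : harm R A = l + g + (2 * A%:R)^-1 - (12 * A%:R ^+ 2)^-1 + e1.
  by rewrite /e1; ring.
have e1b : `|e1| <= (A%:R ^+ 4)^-1 by apply: harm_le.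
pose u := t / A%:R ^+ 2.
have u0 : 0 <= u by rewrite divr_ge0 ?exprn_ge0// ltW.
pose w : R := (2 * X%:R)^-1.
pose e2 := harm R X - (2 * l + (u - u ^+ 2 / 2 + u ^+ 3 / 3) + g + w).
have e2E : harm R X = 2 * l + (u - u ^+ 2 / 2 + u ^+ 3 / 3) + g + w + e2.
  by rewrite /e2; ring.
have lnX : ln X%:R = 2 * l + ln (1 + u).
  have -> : X%:R = A%:R ^+ 2 * (1 + u) :> R.
    by rewrite XE /u; field; rewrite gt_eqF.
  rewrite lnM ?posrE ?exprn_gt0//; last by lra.
  by rewrite lnXn// mulr2n /l; ring.
have wE : w * (X%:R ^+ 4 - 2 * X%:R ^+ 2 - X%:R) = (X%:R ^+ 3 - 2 * X%:R - 1) / 2.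
  by rewrite /w; field; lra.
have A4 : 0 < A%:R ^+ 4 :> R by rewrite exprn_gt0.
have AXR : A%:R ^+ 2 <= X%:R :> R by rewrite -natrX ler_nat; lia.
have A4X : A%:R ^+ 4 <= X%:R ^+ 2 :> R.
  by rewrite -[4%N]/(2 * 2)%N exprM lerXn2r ?nnegrE ?exprn_ge0// ltW.
have XA3 : X%:R <= 3 * A%:R ^+ 2 :> R.
  by rewrite -natrX -natrM ler_nat; nia.
have X2A : X%:R ^+ 2 <= 9 * A%:R ^+ 4 :> R.
  rewrite -[4%N]/(2 * 2)%N exprM; have -> : 9 * (A%:R ^+ 2) ^+ 2 = (3 * A%:R ^+ 2) ^+ 2 :> R by ring.
  by rewrite lerXn2r ?nnegrE//; lra.
have Xp n : 0 < X%:R ^+ n :> R by rewrite exprn_gt0//; lra.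
have X24 : X%:R ^+ 2 <= X%:R ^+ 4 :> R by rewrite ler_weXn2l.
have X14 : X%:R <= X%:R ^+ 4 :> R by rewrite -[leLHS]expr1 ler_weXn2l.
have u2A : u <= 2 / A%:R.
  by rewrite /u ler_pdivrMr ?exprn_gt0// expr2 mulrA divfK// gt_eqF.
have u4 : u ^+ 4 <= 16 / A%:R ^+ 4.
  have -> : 16 / A%:R ^+ 4 = (2 / A%:R) ^+ 4 :> R by field; rewrite gt_eqF.
  by rewrite lerXn2r ?nnegrE// divr_ge0 ?ltW.
(* The first term is [u ^+ 4 / 4] with u <= 2/A; the second covers the error of [harm_le] and the
   term 1/(12 X^2), which [e2] absorbs. *)
have e2b : `|e2| <= 4 / A%:R ^+ 4 + 2 / X%:R ^+ 2.
  have h1 := ln1D_ge R u u0; have h2 := ln1D_le3 R u u0.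
  have := harm_le R X X0; rewrite lnX -/g => h3.
  have h4 : (X%:R ^+ 4)^-1 <= (X%:R ^+ 2)^-1 :> R by rewrite lef_pV2 ?posrE.
  have h5 : (12 * X%:R ^+ 2)^-1 = (X%:R ^+ 2)^-1 / 12 :> R by rewrite invfM mulrC.
  have h6 : 0 < (X%:R ^+ 2)^-1 :> R by rewrite invr_gt0.
  move: h3; rewrite h5 -/w /e2.
  move: h4 h6 u4 h1 h2; move: (X%:R ^+ 4)^-1 (X%:R ^+ 2)^-1 (u ^+ 4) (A%:R ^+ 4)^-1.
  move: (ln (1 + u)) (harm R X) (u ^+ 3) (u ^+ 2) => L H v3 v2 p q v4 r h4 h6 u4' h1 h2.
  by rewrite !ler_norml => /andP[h31 h32]; apply/andP; split; lra.
have := div_sum_le R B X A XB AX XA.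
set S := \sum_(1 <= a < _) _ => hS.
have hI := model_identity R A%:R t l g e1 e2 w X%:R _ _ (lt0r_neq0 a0) XE wE e1E e2E.
have S12 : S = 12 * S / 12 by field.
rewrite S12 sum_quad in hS.
rewrite (sum_div_model_bin R X X0) -/g.
have rem := hyperbola_remainder_le R A%:R A%:R^-1 t g l
  (divff (lt0r_neq0 a0)) a1 (introT andP (conj t0 tA)) (euler_gamma_le2 R)
  (introT andP (conj l0 lA)).
have b1 : `|e1 * (X%:R ^+ 4 - 2 * X%:R ^+ 2) / 12| <= X%:R ^+ 2.
  have c1 : `|X%:R ^+ 4 - 2 * X%:R ^+ 2| <= X%:R ^+ 4 :> R.
    by rewrite ler_norml; apply/andP; split; have := Xp 2%N; lra.
  rewrite normrM (_ : `|12^-1| = 12^-1 :> R); last by rewrite ger0_norm.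
  apply: (@le_trans _ _ ((A%:R ^+ 4)^-1 * X%:R ^+ 4 / 12)).
    by rewrite ler_wpM2r// normrM ler_pM.
  have -> : (A%:R ^+ 4)^-1 * X%:R ^+ 4 / 12 =
      X%:R ^+ 2 * (X%:R ^+ 2 / A%:R ^+ 4 / 12) :> R.
    by field; rewrite gt_eqF.
  rewrite -[leRHS]mulr1 ler_pM2l//.
  have : X%:R ^+ 2 / A%:R ^+ 4 <= 9 :> R by rewrite ler_pdivrMr.
  by lra.
have b2 : `|(X%:R ^+ 4 - 2 * X%:R ^+ 2 - X%:R) / 24 * e2| <= 4 * X%:R ^+ 2.
  rewrite normrM.
  have c1 : `|(X%:R ^+ 4 - 2 * X%:R ^+ 2 - X%:R) / 24| <= X%:R ^+ 4 / 12 :> R.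
    rewrite ler_norml; apply/andP; split; last by have := Xp 2%N; lra.
    by have := Xp 2%N; lra.
  apply: (@le_trans _ _ (X%:R ^+ 4 / 12 * (4 / A%:R ^+ 4 + 2 / X%:R ^+ 2))).
    by apply: ler_pM.
  have -> : X%:R ^+ 4 / 12 * (4 / A%:R ^+ 4 + 2 / X%:R ^+ 2) =
      X%:R ^+ 2 * (X%:R ^+ 2 / A%:R ^+ 4 / 3 + 6^-1) :> R.
    by field; rewrite !gt_eqF//; lra.
  rewrite [leRHS]mulrC ler_pM2l//.
  have : X%:R ^+ 2 / A%:R ^+ 4 <= 9 :> R by rewrite ler_pdivrMr.
  by lra.
have tri (F b r K1 K2 : R) :
    `|F - (r + b)| <= K1 -> `|r| <= K2 -> `|F - b| <= K1 + K2.
  move=> h1 h2; rewrite (_ : F - b = F - (r + b) + r); last by ring.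
  by apply: (le_trans (ler_normD _ _)); apply: lerD.
move: hI hS => /= /eqP; rewrite subr_eq => /eqP -> hS.
(* Together with A^4 from the rows and A^4 <= X^2, the total is 23 X^2. *)
apply: (le_trans (tri _ _ _ _ _ hS (_ : _ <= 17 * A%:R ^+ 4 + X%:R ^+ 2 + 4 * X%:R ^+ 2))).
  apply: (le_trans (ler_normB _ _)); apply: lerD => //.
  by apply: (le_trans (ler_normD _ _)); apply: lerD.
by have := Xp 2%N; move: A4X; move: (A%:R ^+ 4) (X%:R ^+ 2) => p q *; lra.
Qed.

(** * Exact sums over central binomial coefficients *)

Definition cbin (R : realType) (n : nat) : R := 'C(n.*2, n)%:R.

Lemma cbin_gt0 (R : realType) (n : nat) : 0 < cbin R n.
Proof. by rewrite ltr0n bin_gt0 -addnn leq_addr. Qed.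

Lemma cbinS (R : realType) (n : nat) :
  n.+1%:R * cbin R n.+1 = 2 * (2 * n%:R + 1) * cbin R n.
Proof.
rewrite /cbin.
have e : ('C(n.*2.+1, n) = 'C(n.*2.+1, n.+1))%N.
  by rewrite -bin_sub; [congr 'C(_, _)|]; lia.
have h1 : (n.*2.+1 * 'C(n.*2, n) = n.+1 * 'C(n.*2.+1, n.+1))%N by rewrite -mul_bin_diag.
have h : (n.+1 * 'C(n.+1.*2, n.+1) = 2 * (2 * n + 1) * 'C(n.*2, n))%N.
  by rewrite doubleS binS e; lia.
have := congr1 (fun k => k%:R : R) h.
by rewrite !natrM natrD natrM.
Qed.

(* Normalised by rho 1 = 1, so that (2N - 1) rho N is (n + 1)/c(0) times the
   decrement c(N - 1) - c(N), where c(k) = binom(2n, n + k). *)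
Definition rho (R : realType) (n N : nat) : R :=
  'C(n.*2.+1, n + N)%:R * (n.+1%:R / (n.*2.+1%:R * cbin R n)).

Lemma rho_ge0 (R : realType) (n N : nat) : 0 <= rho R n N.
Proof. by rewrite mulr_ge0 ?divr_ge0 ?mulr_ge0// ltW// cbin_gt0. Qed.

Lemma rho1 (R : realType) (n : nat) : rho R n 1 = 1.
Proof.
have h := congr1 (fun k => k%:R : R) (mul_bin_diag n.*2.+1 n); rewrite /= !natrM in h.
have c0 := cbin_gt0 R n; rewrite /rho addn1 mulrA [_ * n.+1%:R]mulrC -h.
by rewrite -/(cbin R n) divff//; apply: mulf_neq0; [rewrite pnatr_eq0|exact: lt0r_neq0].
Qed.

Lemma rho_out (R : realType) (n N : nat) : (n.+1 < N)%N -> rho R n N = 0.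
Proof. by move=> nN; rewrite /rho bin_small ?mul0r//; lia. Qed.

Lemma rhoS (R : realType) (n N : nat) :
  (n%:R + 1 + N%:R) * rho R n N.+1 = (n%:R + 1 - N%:R) * rho R n N.
Proof.
have [nN|nN] := leqP N n.+1; last by rewrite !rho_out ?mulr0//; lia.
have h := congr1 (fun k => k%:R : R) (mul_bin_left n.*2.+1 (n + N)).
rewrite !natrM (_ : n.*2.+1 - (n + N) = n.+1 - N)%N in h; last by lia.
rewrite natrB // -!natr1 natrD in h.
rewrite /rho addnS !mulrA -h; congr (_ * _ * _); ring.
Qed.

Lemma rho_le1 (R : realType) (n N : nat) : rho R n N.+1 <= 1.
Proof.
elim: N => [|N IH]; first by rewrite rho1.
have := rhoS R n N.+1; have := rho_ge0 R n N.+1; have := rho_ge0 R n N.+2.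
move: (rho R n N.+1) (rho R n N.+2) IH => a b a1 b0 a0 h.
have n0 : 0 <= n%:R :> R by [].
have N0 : 0 <= N.+1%:R :> R by [].
move: (n%:R : R) (N.+1%:R : R) n0 N0 h => x y x0 y0 h.
rewrite leNgt; apply/negP => b1; nra.
Qed.

(** By [rhoS], the values a, b at N + 1 and N + 2 satisfy (n + 1)(a - b) = (N + 1)(a + b) <= 2(N +
    1), and these increments add up. *)
Lemma rho_ge (R : realType) (n N : nat) :
  1 - N%:R * (N%:R + 1) / n.+1%:R <= rho R n N.+1.
Proof.
elim: N => [|N IH]; first by rewrite rho1 !mul0r subr0.
have := rhoS R n N.+1; have := rho_ge0 R n N.+1; have := rho_ge0 R n N.+2.
have := rho_le1 R n N; have := rho_le1 R n N.+1.
move: IH; rewrite -[n.+1%:R]natr1 -[N.+1%:R]natr1.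
have n0 : 0 <= n%:R :> R by [].
have N0 : 0 <= N%:R :> R by [].
move: (n%:R : R) (N%:R : R) n0 N0 (rho R n N.+1) (rho R n N.+2).
move=> x y x0 y0 a b IH b1 a1 b0 a0 h.
have x1 : 0 < x + 1 by lra.
rewrite lerBlDr -lerBlDl ler_pdivlMr//.
move: IH; rewrite lerBlDr -lerBlDl ler_pdivlMr// => IH.
have e : (x + 1) * (a - b) = (y + 1) * (a + b) by lra.
have : (y + 1) * (a + b) <= (y + 1) * 2 by apply: ler_wpM2l; lra.
lra.
Qed.

Lemma sum_odd_rho (R : realType) (n B : nat) : (n.+1 < B)%N ->
  \sum_(1 <= N < B) (2 * N%:R - 1) * rho R n N = n.+1%:R.
Proof.
move=> nB; pose T (N : nat) := - ((n%:R + N%:R) * rho R n N).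
rewrite (eq_bigr (fun N => T N.+1 - T N)) => [|N _]; last first.
  rewrite /T -[N.+1%:R]natr1 addrA [_ + _ + 1]addrAC rhoS; ring.
rewrite telescope_sumr; last by lia.
by rewrite /T rho_out// rho1 mulr0 oppr0 opprK add0r mulr1 natr1.
Qed.

Lemma rho_step (R : realType) (n N : nat) : (0 < N)%N ->
  (n%:R + 1) * (n%:R + 2) * rho R n N =
  ((n%:R + 1) * (n%:R + 2) - N%:R * (N%:R - 1)) * rho R n.+1 N.
Proof.
case: N => // N _; elim: N => [|N IH]; first by rewrite !rho1; ring.
have h0 := rhoS R n N.+1; have h1 := rhoS R n.+1 N.+1; move: IH h0 h1.
rewrite -[n.+1%:R]natr1 -[N.+2%:R]natr1.
have n0 : 0 <= n%:R :> R by [].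
have N0 : 0 <= N.+1%:R :> R by [].
move: (n%:R : R) (N.+1%:R : R) n0 N0 (rho R n N.+1) (rho R n N.+2)
  (rho R n.+1 N.+1) (rho R n.+1 N.+2) => x y x0 y0 a b c d IH h0 h1.
have xy : x + 1 + y != 0 by lra.
apply: (mulfI xy).
transitivity ((x + 1) * (x + 2) * ((x + 1 + y) * b)); first by ring.
rewrite h0; transitivity ((x + 1 - y) * ((x + 1) * (x + 2) * a)); first by ring.
rewrite IH; transitivity ((x + 1 - y) * (x + 1 + y) * ((x + 1 + 1 - y) * c)); first by ring.
rewrite -h1; ring.
Qed.

Definition rho_sum (R : realType) (n : nat) : R :=
  n.+1%:R * 4 ^+ n / (n.*2.+1%:R * cbin R n).

(** The row 2n + 1 is symmetric without a middle entry, so its upper half adds up to [4 ^+ n]. *)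
Lemma sum_rho (R : realType) (n B : nat) : (n.+1 < B)%N ->
  \sum_(1 <= N < B) rho R n N = rho_sum R n.
Proof.
move=> nB.
have upper : (\sum_(1 <= N < n.+2) 'C(n.*2.+1, n + N) = 4 ^ n)%N.
  apply: double_inj; rewrite -addnn.
  have -> : ((4 ^ n).*2 = 2 ^ n.*2.+1)%N by rewrite expnS -mul2n -[n.*2]mul2n expnM.
  have := expnDn 1 1 n.*2.+1; rewrite addn1 => ->.
  under [RHS]eq_bigr do rewrite !exp1n !muln1.
  rewrite -(big_mkord xpredT (fun i => 'C(n.*2.+1, i))).
  rewrite [RHS](@big_cat_nat _ _ _ n.+1) //=; last by lia.
  congr (_ + _)%N; last first.
    rewrite -[n.+1 in RHS]addn1 addnC big_addn (_ : n.*2.+2 - n = n.+2)%N; last by lia.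
    by apply: eq_bigr => i _; rewrite addnC.
  rewrite big_add1 /= [RHS]big_nat_rev /=; apply: eq_big_nat => i /andP[_ ni].
  by rewrite -[RHS]bin_sub; [congr 'C(_, _)|]; lia.
rewrite /rho_sum -mulr_suml (@big_cat_nat _ _ _ n.+2) //=.
rewrite [X in _ + X]big_nat [X in _ + X]big1 ?addr0; last first.
  by move=> N /andP[nN _]; rewrite bin_small//; lia.
by rewrite -natr_sum upper natrX mulrCA mulrA.
Qed.

Lemma rho_sumS (R : realType) (n : nat) :
  (2 * n%:R + 3) * (n%:R + 1) * rho_sum R n.+1 =
  (2 * n%:R + 2) * (n%:R + 2) * rho_sum R n.
Proof.
rewrite /rho_sum; have h := cbinS R n; have := cbin_gt0 R n; have := cbin_gt0 R n.+1.
move: h; rewrite doubleS -[n.+2%:R]natr1 -[n.*2.+3%:R]natr1 -[n.*2.+2%:R]natr1.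
rewrite -[n.*2.+1%:R]natr1 -[n.+1%:R]natr1 -muln2 natrM exprS.
have n0 : 0 <= n%:R :> R by [].
have E0 : 0 < 4 ^+ n :> R by rewrite exprn_gt0.
move: (n%:R : R) n0 (4 ^+ n) E0 (cbin R n) (cbin R n.+1) => x x0 E E0 c d h d0 c0.
have -> : c = (x + 1) * d / (2 * (2 * x + 1)) by rewrite h; field; lra.
by field; lra.
Qed.

(** Induction on [n]: by [rho_step], passing to [n.+1] adds a combination of [sum_odd_rho] and
    [sum_rho], free of the division by N. The former contributes 1/(2(n + 1)) each time; this
    harmonic number is the origin of -log n. *)
Lemma sum_rho_div (R : realType) (n B : nat) : (n.+1 < B)%N ->
  \sum_(1 <= N < B) rho R n N / N%:R = harm R n / 2 + rho_sum R n / n.+1%:R.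
Proof.
elim: n B => [|n IH] B nB.
  rewrite harm0 mul0r add0r /rho_sum expr0 /cbin bin0 !mulr1 divff// divr1.
  rewrite big_ltn; last by lia.
  rewrite rho1 divr1 big_nat big1 ?addr0// => N /andP[N2 _].
  by rewrite rho_out ?mul0r.
have nB' : (n.+1 < B)%N by lia.
have n1 : n%:R + 1 != 0 :> R by rewrite natr1 pnatr_eq0.
have n2 : n%:R + 2 != 0 :> R by rewrite -natrD pnatr_eq0 addn2.
have stepE : \sum_(1 <= N < B) rho R n.+1 N / N%:R =
    \sum_(1 <= N < B) rho R n N / N%:R
    + (\sum_(1 <= N < B) (2 * N%:R - 1) * rho R n.+1 N
       - \sum_(1 <= N < B) rho R n.+1 N) / (2 * (n%:R + 1) * (n%:R + 2)).
  rewrite -sumrB mulr_suml -big_split /=; apply: eq_big_nat => N /andP[N0 _].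
  have N1 : N%:R != 0 :> R by rewrite pnatr_eq0 -lt0n.
  have -> : rho R n N = ((n%:R + 1) * (n%:R + 2) - N%:R * (N%:R - 1)) * rho R n.+1 N
      / ((n%:R + 1) * (n%:R + 2)).
    by rewrite -rho_step// mulrAC divff ?mul1r// mulf_neq0.
  by field; rewrite N1 n1 n2.
rewrite stepE IH// sum_odd_rho// sum_rho// harmS.
have h := rho_sumS R n.
have -> : rho_sum R n = (2 * n%:R + 3) * (n%:R + 1) * rho_sum R n.+1
    / (2 * (n%:R + 1) * (n%:R + 2)).
  rewrite h (_ : 2 * n%:R + 2 = 2 * (n%:R + 1)); last by ring.
  by rewrite mulrAC divff ?mul1r// !mulf_neq0// pnatr_eq0.
rewrite -[n.+2%:R]natr1 -[n.+1%:R]natr1.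
have n2' : n%:R + 1 + 1 != 0 :> R by rewrite -addrA.
by field; rewrite ?n1 ?n2 ?n2'.
Qed.

(** * The harmonic model summed against the second differences *)

Definition beta (R : realType) (n N : nat) : R := (2 * N%:R - 1) * rho R n N.

Lemma rho0 (R : realType) (n : nat) : rho R n 0 = 1.
Proof.
have := rhoS R n 0; rewrite rho1 mulr1 subr0 addr0 => h.
have n1 : n%:R + 1 != 0 :> R by rewrite natr1 pnatr_eq0.
by apply: (mulfI n1); rewrite -h mulr1.
Qed.

Lemma beta0 (R : realType) (n : nat) : beta R n 0 = -1.
Proof. by rewrite /beta rho0 mulr0 sub0r mulr1. Qed.

Lemma beta1 (R : realType) (n : nat) : beta R n 1 = 1.
Proof. by rewrite /beta rho1 !mulr1; lra. Qed.

Lemma abel_sum (R : realType) (m b : nat -> R) (k : nat) :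
  \sum_(1 <= N < k.+2) m N * (b N.-1 - b N) =
  m 1 * b 0 + \sum_(1 <= N < k.+1) (m N.+1 - m N) * b N - m k.+1 * b k.+1.
Proof.
elim: k => [|k IH]; first by rewrite big_nat1 big_geq // addr0 mulrBr.
by rewrite big_nat_recr //= IH [in RHS]big_nat_recr //=; ring.
Qed.

(** What is left of 2N - 1 times the increment of the model once 2 - 2/N is removed. It decays like
    N^(-2), and its full sum 11/8 enters the constant term. *)
Definition model_tail (R : realType) (N : nat) : R :=
  3 / 2 * (N%:R^-1 - N.+1%:R^-1)
  - 6^-1 * ((2 * N%:R - 1) / (N%:R * N.+1%:R * N.+2%:R)).

Lemma div_model_beta (R : realType) (n N : nat) : (0 < N)%N ->
  (harm R N.+1 - N.+1%:R^-1 / 2 + (N.+1%:R^-1 - N.+2%:R^-1) / 12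
   - (harm R N - N%:R^-1 / 2 + (N%:R^-1 - N.+1%:R^-1) / 12)) * beta R n N =
  2 * rho R n N - 2 * (rho R n N / N%:R) + rho R n N * model_tail R N.
Proof.
move=> N0; rewrite /beta /model_tail harmS -[N.+2%:R]natr1 -[N.+1%:R]natr1.
have y0 : N%:R != 0 :> R by rewrite pnatr_eq0 -lt0n.
have y1 : N%:R + 1 != 0 :> R by rewrite natr1 pnatr_eq0.
have y2 : N%:R + 1 + 1 != 0 :> R by rewrite !natr1 pnatr_eq0.
move: (N%:R : R) y0 y1 y2 (harm R N) (rho R n N) => y y0 y1 y2 H r.
by field; rewrite y0 y1 y2.
Qed.

Lemma sum_model_tail (R : realType) (k : nat) :
  \sum_(1 <= N < k.+1) model_tail R N =
  11 / 8 - 19 / 12 * k.+1%:R^-1 + 5 / 12 * k.+2%:R^-1.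
Proof.
elim: k => [|k IH].
  by rewrite big_geq //; field.
rewrite big_nat_recr //= IH /model_tail -[k.+3%:R]natr1 -[k.+2%:R]natr1.
have y0 : k.+1%:R != 0 :> R by rewrite pnatr_eq0.
have y1 : k.+1%:R + 1 != 0 :> R by rewrite natr1 pnatr_eq0.
have y2 : k.+1%:R + 1 + 1 != 0 :> R by rewrite !natr1 pnatr_eq0.
move: (k.+1%:R : R) y0 y1 y2 => y y0 y1 y2.
by field; rewrite y0 y1 y2.
Qed.

Lemma model_tail_bounds (R : realType) (N : nat) :
  0 <= model_tail R N.+1 <= 2 / N.+1%:R ^+ 2.
Proof.
rewrite /model_tail -[N.+3%:R]natr1 -[N.+2%:R]natr1.
have : 1 <= N.+1%:R :> R by rewrite ler1n.
move: (N.+1%:R : R) => y y1.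
have y0 : y != 0 by lra.
have ys : y + 1 != 0 by lra.
have yss : y + 1 + 1 != 0 by lra.
have p : 0 < y * (y + 1) * (y + 1 + 1) by rewrite !mulr_gt0//; lra.
have -> : 3 / 2 * (y^-1 - (y + 1)^-1)
    - 6^-1 * ((2 * y - 1) / (y * (y + 1) * (y + 1 + 1))) =
    (14 * y + 38) / 12 / (y * (y + 1) * (y + 1 + 1)).
  by field; rewrite y0 ys yss.
apply/andP; split; first by rewrite divr_ge0 ?ltW//; lra.
rewrite ler_pdivrMr// mulrAC ler_pdivlMr ?exprn_gt0//; last by lra.
have y2 : 0 <= y ^+ 2 by rewrite exprn_ge0//; lra.
have y3 : y ^+ 2 <= y ^+ 3 by rewrite ler_weXn2l.
have y11 : y <= y ^+ 2 by rewrite -[leLHS]expr1 ler_weXn2l.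
have -> : 2 * (y * (y + 1) * (y + 1 + 1)) = 2 * y ^+ 3 + 6 * y ^+ 2 + 4 * y by ring.
have -> : (14 * y + 38) / 12 * y ^+ 2 = 14 / 12 * y ^+ 3 + 38 / 12 * y ^+ 2 by ring.
by lra.
Qed.

(** One telescoping expression dominates both regimes N < y and N >= y of the minimum, so its sum
    over N is at most 4/y without cutting the range. *)
Lemma inv_sq_telescope (R : realType) (y N : R) : 0 < y -> 1 <= N ->
  Num.min (N ^+ 2 / y ^+ 2) 1 / N ^+ 2 <= 4 * ((N - 1 + y)^-1 - (N + y)^-1).
Proof.
move=> y0 N1; have N0 : 0 < N by lra.
have a0 : 0 < N - 1 + y by lra.
have b0 : 0 < N + y by lra.
have -> : 4 * ((N - 1 + y)^-1 - (N + y)^-1) = 4 / ((N - 1 + y) * (N + y)).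
  by field; rewrite !gt_eqF.
have N2 : 0 < N ^+ 2 by rewrite exprn_gt0.
have y2 : 0 < y ^+ 2 by rewrite exprn_gt0.
rewrite ler_pdivlMr ?mulr_gt0// mulrAC ler_pdivrMr//.
have [yN|Ny] := leP y N.
  apply: (@le_trans _ _ (1 * ((N - 1 + y) * (N + y)))).
    by apply: ler_wpM2r; [apply: mulr_ge0; lra|rewrite ge_min lexx orbT].
  by rewrite mul1r expr2; nra.
apply: (@le_trans _ _ (N ^+ 2 / y ^+ 2 * ((N - 1 + y) * (N + y)))).
  by apply: ler_wpM2r; [apply: mulr_ge0; lra|rewrite ge_min lexx].
rewrite mulrAC ler_pdivrMr// [leRHS](_ : _ = N ^+ 2 * (4 * y ^+ 2)); last by ring.
rewrite ler_wpM2l ?ltW//.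
by rewrite expr2; nra.
Qed.

Lemma rho_defect (R : realType) (n N : nat) :
  1 - rho R n N.+1 <= Num.min (N.+1%:R ^+ 2 / n.+1%:R) 1.
Proof.
rewrite le_min; apply/andP; split; last by have := rho_ge0 R n N.+1; lra.
rewrite lerBlDl -lerBlDr; apply: le_trans (rho_ge R n N).
rewrite lerB// ler_wpM2r ?invr_ge0// -natr1.
have N0 : 0 <= N%:R :> R by [].
by rewrite expr2 ler_wpM2r//; lra.
Qed.

(** The price of replacing [rho] by 1: a defect of order N^2/n up to sqrt n and at most 1 beyond,
    against a tail of order N^(-2). *)
Lemma sum_model_tail_defect (R : realType) (n k : nat) :
  0 <= \sum_(1 <= N < k.+1) model_tail R N * (1 - rho R n N)
    <= 8 / Num.sqrt n.+1%:R.
Proof.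
set y := Num.sqrt _; have y0 : 0 < y by rewrite sqrtr_gt0.
have y2 : y ^+ 2 = n.+1%:R by rewrite sqr_sqrtr.
have bnd N : (0 < N)%N -> 0 <= model_tail R N * (1 - rho R n N) <=
    8 * ((N.-1%:R + y)^-1 - (N%:R + y)^-1).
  case: N => // N _; have /andP[t0 t2] := model_tail_bounds R N.
  have r1 := rho_le1 R n N.
  rewrite mulr_ge0//=; last by lra.
  apply: (@le_trans _ _ (2 / N.+1%:R ^+ 2 * Num.min (N.+1%:R ^+ 2 / y ^+ 2) 1)).
    by apply: ler_pM => //; [lra|rewrite y2; exact: rho_defect].
  have N1 : 1 <= N.+1%:R :> R by rewrite ler1n.
  have := inv_sq_telescope R y N.+1%:R y0 N1.
  rewrite (_ : N.+1%:R - 1 = N%:R :> R); last by rewrite -natr1 addrK.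
  rewrite [2 / _ * _]mulrAC -mulrA; set v := _ - _.
  by move: (Num.min _ _ / _) v => u v; lra.
apply/andP; split.
  by rewrite big_nat sumr_ge0// => N /andP[N0 _]; have /andP[] := bnd N N0.
apply: (@le_trans _ _ (\sum_(1 <= N < k.+1)
    8 * ((N.-1%:R + y)^-1 - (N%:R + y)^-1))).
  by rewrite !big_nat; apply: ler_sum => N /andP[N0 _]; have /andP[] := bnd N N0.
rewrite -mulr_sumr ler_pM2l// big_add1 /=.
rewrite (eq_bigr (fun N => - (N.+1%:R + y)^-1 - - (N%:R + y)^-1)) => [|N _]; last first.
  by rewrite opprK addrC.
rewrite telescope_sumr// add0r opprK gerDr oppr_le0 invr_ge0.
by rewrite addr_ge0// ltW.
Qed.

(** The constant 3/2 is -13/24 from the boundary term of Abel summation, 2/3 from the mass at N = 1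
    and 11/8 from the tail. The constant part gamma of the model and its mass at N = 1 contribute
    -gamma each. *)
Lemma sum_div_model_beta (R : realType) (n k : nat) : (n.+1 < k)%N ->
  `|\sum_(1 <= N < k.+2) div_model R N * (beta R n N.-1 - beta R n N)
    - (3 / 2 - 2 * euler_gamma R - harm R n
       + 2 * n%:R / n.+1%:R * rho_sum R n)| <=
  8 / Num.sqrt n.+1%:R + 2 / n.+1%:R.
Proof.
move=> nk; set g := euler_gamma R.
pose m (N : nat) : R := harm R N - N%:R^-1 / 2 + (N%:R^-1 - N.+1%:R^-1) / 12.
have split : \sum_(1 <= N < k.+2) div_model R N * (beta R n N.-1 - beta R n N) =
   \sum_(1 <= N < k.+2) m N * (beta R n N.-1 - beta R n N)
   + g * (\sum_(1 <= N < k.+2) (beta R n N.-1 - beta R n N))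
   - 2 * (g / 2 - 3^-1).
  rewrite [X in _ = _ - X](_ : _ = - \sum_(1 <= N < k.+2)
     (N == 1)%:R * (g / 2 - 3^-1) * (beta R n N.-1 - beta R n N)); last first.
    rewrite big_ltn //= beta0 beta1 mul1r big_nat_cond big1 ?addr0; first by lra.
    by move=> [|[|N]] //= _; rewrite !mul0r.
  rewrite opprK mulr_sumr -!big_split /=; apply: eq_bigr => N _.
  by rewrite /div_model -/g /m; ring.
have bk : beta R n k.+1 = 0 by rewrite /beta rho_out ?mulr0//; lia.
have tel : \sum_(1 <= N < k.+2) (beta R n N.-1 - beta R n N) = -1.
  rewrite big_add1 /= (eq_bigr (fun N => - beta R n N.+1 - - beta R n N)) => [|N _].
    by rewrite telescope_sumr// bk beta0 oppr0 opprK add0r.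
  by rewrite opprK addrC.
rewrite split tel abel_sum bk mulr0 subr0 beta0.
have -> : \sum_(1 <= N < k.+1) (m N.+1 - m N) * beta R n N =
   2 * rho_sum R n - 2 * (harm R n / 2 + rho_sum R n / n.+1%:R)
   + (\sum_(1 <= N < k.+1) model_tail R N
      - \sum_(1 <= N < k.+1) model_tail R N * (1 - rho R n N)).
  rewrite -(sum_rho_div R n k.+1); last by lia.
  rewrite -(sum_rho R n k.+1); last by lia.
  rewrite -sumrB !mulr_sumr -sumrB -big_split /=; apply: eq_big_nat => N /andP[N0 _].
  by rewrite /m div_model_beta//; ring.
have m1 : m 1%N = 1 / 2 + 1 / 24 by rewrite /m harmS harm0; field.
rewrite m1 sum_model_tail.
have /andP[] := sum_model_tail_defect R n k.
set D := \sum_(1 <= N < k.+1) _.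
have n1 : n%:R + 1 != 0 :> R by rewrite natr1 pnatr_eq0.
have e : 2 * n%:R / n.+1%:R * rho_sum R n =
    2 * rho_sum R n - 2 * (rho_sum R n / n.+1%:R).
  by rewrite -natr1; field.
have k1 : 0 <= (k.+1%:R^-1 : R) <= n.+1%:R^-1.
  by rewrite invr_ge0 ler0n lef_pV2 ?posrE// ler_nat; lia.
have k2 : 0 <= (k.+2%:R^-1 : R) <= n.+1%:R^-1.
  by rewrite invr_ge0 ler0n lef_pV2 ?posrE// ler_nat; lia.
rewrite e; move: k1 k2; move: (rho_sum R n / n.+1%:R) (rho_sum R n) (8 / Num.sqrt n.+1%:R).
move: (k.+1%:R^-1) (k.+2%:R^-1) (n.+1%:R^-1) (harm R n) => a b c H z P q.
move=> /andP[a0 a1] /andP[b0 b1] D0 D1.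
by rewrite ler_norml; apply/andP; split; lra.
Qed.

(** * The Wallis bounds *)

(** The integral of sin^n over [0, pi/2], given by its reduction formula. *)
Fixpoint wallis (R : realType) (n : nat) : R :=
  match n with
  | 0 => pi / 2
  | 1 => 1
  | n'.+2 => n'.+1%:R / n'.+2%:R * wallis R n'
  end.

(** Explicit primitives stand in for integrals. Two consecutive exponents are carried along because
    the reduction formula lowers the exponent by two. *)
Lemma wallis_primitive (R : realType) (n : nat) :
  exists F : R -> R, (forall x : R, is_derive x 1 F (sin x ^+ n)) /\
    F (pi / 2) - F 0 = wallis R n.
Proof.
suff [] : (exists F : R -> R, (forall x : R, is_derive x 1 F (sin x ^+ n)) /\
      F (pi / 2) - F 0 = wallis R n) /\
    (exists F : R -> R, (forall x : R, is_derive x 1 F (sin x ^+ n.+1)) /\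
      F (pi / 2) - F 0 = wallis R n.+1) by [].
elim: n => [|n [[F [dF F0]] IH]].
  split; first by exists id; split => [x|]; [rewrite expr0; exact: is_derive_id|rewrite subr0].
  exists (fun x => - cos x); split => [x|].
    by apply: is_derive_eq; rewrite opprK expr1.
  by rewrite cos_pihalf cos0 /= oppr0 add0r opprK.
split=> //.
pose k : R := n.+2%:R^-1.
exists (fun x => - k * (sin x ^+ n.+1 * cos x) + n.+1%:R * k * F x); split => [x|]; last first.
  rewrite cos_pihalf mulr0 sin0 expr0n /= mul0r !mulr0 !add0r -mulrBr F0 /=.
  by rewrite /k.
have dFx := dF x.
rewrite (_ : (fun x => _) = (- k) \*: ((@sin R) ^+ n.+1 * (@cos R)) + (n.+1%:R * k) \*: F); last first.
  by apply/funext => y; rewrite !fctE.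
apply: is_derive_eq; rewrite /GRing.scale /= fctE.
have k1 : n.+2%:R * k = 1 by rewrite /k divff // pnatr_eq0.
have c2 : cos x ^+ 2 = 1 - sin x ^+ 2 by have := cos2Dsin2 x; lra.
move: c2 k1; rewrite !exprS expr0 mulr1 -[n.+2%:R]natr1.
move: (sin x) (cos x) (sin x ^+ n) (n.+1%:R : R) => sx cx e m c2 k1.
transitivity (k * sx * sx * e + m * k * e * (1 - cx * cx)); first by ring.
rewrite c2; transitivity ((m + 1) * k * (sx * (sx * e))); first by ring.
by rewrite k1 mul1r.
Qed.

Lemma wallis_decr (R : realType) (n : nat) : wallis R n.+1 <= wallis R n.
Proof.
have [F [dF <-]] := wallis_primitive R n; have [G [dG <-]] := wallis_primitive R n.+1.
suff : F 0 - G 0 <= F (pi / 2) - G (pi / 2) by lra.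
have pi0 := pi_gt0 R.
have pi20 : 0 <= pi / 2 :> R by lra.
apply: (@le_of_is_derive_ge0 R (F - G)
  (fun x => sin x ^+ n - sin x ^+ n.+1) _ _ pi20).
move=> x /andP[x0 x1].
have s0 : 0 <= sin x by apply: sin_ge0_pi; apply/andP; split; lra.
by rewrite exprS subr_ge0 ler_piMl ?exprn_ge0// sin_le1.
Qed.

Lemma wallis_even (R : realType) (n : nat) :
  wallis R n.*2 = pi / 2 * cbin R n / 4 ^+ n.
Proof.
elim: n => [|n IH]; first by rewrite /= /cbin bin0 expr0 divr1 mulr1.
rewrite doubleS /= IH exprS.
have h := cbinS R n; have n1 : n.+1%:R != 0 :> R by rewrite pnatr_eq0.
have -> : cbin R n.+1 = 2 * (2 * n%:R + 1) * cbin R n / n.+1%:R by rewrite -h mulrC mulKf.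
have E0 : 4 ^+ n != 0 :> R by rewrite expf_neq0.
have -> : n.*2.+1%:R = 2 * n%:R + 1 :> R by rewrite -natr1 -mul2n natrM.
have -> : n.*2.+2%:R = 2 * n.+1%:R :> R by rewrite -doubleS -mul2n natrM.
move: (n.+1%:R : R) n1 (n%:R : R) (4 ^+ n) E0 (cbin R n) => m m0 x E E0 c.
by field; rewrite m0 E0.
Qed.

Lemma wallis_odd (R : realType) (n : nat) :
  wallis R n.*2.+1 = 4 ^+ n / (n.*2.+1%:R * cbin R n).
Proof.
elim: n => [|n IH]; first by rewrite /= /cbin bin0 expr0 !mulr1 divr1.
rewrite doubleS exprS.
have -> : wallis R n.*2.+3 = n.*2.+2%:R / n.*2.+3%:R * wallis R n.*2.+1 by [].
rewrite IH.
have h := cbinS R n; have n1 : n.+1%:R != 0 :> R by rewrite pnatr_eq0.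
have c0 := lt0r_neq0 (cbin_gt0 R n).
have -> : cbin R n.+1 = 2 * (2 * n%:R + 1) * cbin R n / n.+1%:R by rewrite -h mulrC mulKf.
have e1 : n.*2.+1%:R = 2 * n%:R + 1 :> R by rewrite -natr1 -mul2n natrM.
have x1 : n.*2.+1%:R != 0 :> R by rewrite pnatr_eq0.
have x3 : n.*2.+3%:R != 0 :> R by rewrite pnatr_eq0.
have -> : n.*2.+2%:R = 2 * n.+1%:R :> R by rewrite -doubleS -mul2n natrM.
rewrite -e1; move: (n.+1%:R : R) n1 (n.*2.+1%:R : R) x1 (n.*2.+3%:R : R) x3.
move: (4 ^+ n) (cbin R n) c0 => E c c0 m m0 x x0 y y0.
by field; rewrite m0 c0 x0 y0.
Qed.

Lemma wallis_bounds (R : realType) (n : nat) :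
  pi * n%:R <= (4 ^+ n / cbin R n) ^+ 2 <= pi * (n%:R + 2^-1).
Proof.
have := wallis_decr R n.*2; have := wallis_decr R n.*2.+1.
rewrite [wallis R n.*2.+2]/= wallis_even wallis_odd.
have c0 := cbin_gt0 R n; have pi0 := pi_gt0 R.
have E0 : 0 < 4 ^+ n :> R by rewrite exprn_gt0.
have -> : n.*2.+2%:R = 2 * (n%:R + 1) :> R by rewrite natr1 -doubleS -mul2n natrM.
have -> : n.*2.+1%:R = 2 * n%:R + 1 :> R by rewrite -natr1 -mul2n natrM.
have x0 : 0 <= n%:R :> R by [].
set a := 4 ^+ n / cbin R n; have a0 : 0 < a by rewrite divr_gt0.
have -> : pi / 2 * cbin R n / 4 ^+ n = pi / 2 / a.
  by rewrite /a; field; rewrite !gt_eqF.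
have -> : 4 ^+ n / ((2 * n%:R + 1) * cbin R n) = a / (2 * n%:R + 1).
  by rewrite /a; field; rewrite gt_eqF//=; lra.
move: (n%:R : R) x0 (pi : R) pi0 a a0 => x x0 p p0 a a0.
move=> h1 h2; apply/andP; split; last first.
  move: h2; rewrite ler_pdivlMr// mulrAC ler_pdivrMr; last by lra.
  by rewrite -expr2; lra.
(* The lower bound then follows from (2x + 1)^2 >= 4x(x + 1). *)
have : (2 * x + 1) * (2 * x + 1) * (p / 2) <= a ^+ 2 * (2 * (x + 1)).
  have b1 : 0 < 2 * (x + 1) by lra.
  have b2 : 0 < 2 * x + 1 by lra.
  rewrite -subr_ge0.
  have -> : a ^+ 2 * (2 * (x + 1)) - (2 * x + 1) * (2 * x + 1) * (p / 2) =
    (a * (2 * (x + 1)) * (2 * x + 1)) *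
      (a / (2 * x + 1) - (2 * x + 1) / (2 * (x + 1)) * (p / 2 / a)).
    by field; do ?(apply/andP; split); lra.
  by rewrite mulr_ge0 ?subr_ge0//; apply: mulr_ge0; [apply: mulr_ge0|]; lra.
nra.
Qed.

(** * Sixth differences of binomial coefficients *)

Lemma bin_diagR (R : realType) (m J : nat) :
  'C(m, J)%:R * m.+1%:R = 'C(m.+1, J.+1)%:R * J.+1%:R :> R.
Proof.
by rewrite -!natrM; congr (_%:R); have := mul_bin_diag m.+1 J => /= h; rewrite mulnC h mulnC.
Qed.

Lemma bin_downR (R : realType) (m J : nat) :
  'C(m, J)%:R * (m%:R + 1) = 'C(m.+1, J)%:R * (m%:R + 1 - J%:R) :> R.
Proof.
have [Jm|mJ] := leqP J m.+1; last by rewrite !bin_small ?mul0r // ltnW.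
have h := congr1 (fun k => k%:R : R) (mul_bin_down m.+1 J).
rewrite /= !natrM natrB // -natr1 in h.
by rewrite mulrC h mulrC.
Qed.

(** Used with [s + r = 6]: the entries of a sixth difference all become polynomial multiples of one
    binomial coefficient of the row m + 6. *)
Lemma bin_shift (R : realType) (m J s r : nat) :
  'C(m, J)%:R * \prod_(1 <= l < (s + r).+1) (m%:R + l%:R) =
  'C(m + s + r, J + s)%:R * \prod_(1 <= l < s.+1) (J%:R + l%:R)
   * \prod_(1 <= l < r.+1) (m%:R - J%:R + l%:R) :> R.
Proof.
elim: r s => [|r IH] s.
  rewrite !addn0 [X in _ = _ * X]big_geq // mulr1.
  elim: s => [|s IH]; first by rewrite !addn0 !big_geq.
  rewrite [in LHS]big_nat_recr //= [in RHS]big_nat_recr //= mulrA IH -!natrD !addnS.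
  by rewrite mulrAC bin_diagR -mulrA [_ * \prod_(_ <= _ < _) _]mulrC.
rewrite addnS [in LHS]big_nat_recr //= mulrA IH.
rewrite [X in _ = _ * X]big_nat_recr //= [RHS]mulrA.
have key := bin_downR R (m + s + r) (J + s).
set P := \prod_(_ <= _ < s.+1) _; set Q := \prod_(_ <= _ < r.+1) _.
rewrite [in LHS]mulrAC [in LHS](mulrAC _ P) [(m + s + r.+1)%N]addnS.
have -> : m%:R + (s + r).+1%:R = (m + s + r)%:R + 1 :> R by rewrite natr1 -natrD -addnA addnS.
rewrite key; have -> : (m + s + r)%:R + 1 - (J + s)%:R = m%:R - J%:R + r.+1%:R :> R.
  by rewrite -[r.+1%:R]natr1 !natrD; ring.
by ring.
Qed.

Lemma sum_bin_step (R : realType) (L : nat) (f : nat -> R) :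
  \sum_(0 <= J < L.+2) 'C(L.+1, J)%:R * f J =
  \sum_(0 <= J < L.+1) 'C(L, J)%:R * (f J + f J.+1).
Proof.
under [RHS]eq_bigr do rewrite mulrDr.
rewrite big_split /= big_nat_recl // bin0 mul1r.
under [X in _ + X = _]eq_bigr do rewrite binS natrD mulrDl.
rewrite big_split /= addrA; congr (_ + _).
rewrite big_nat_recr //= bin_small // mul0r addr0.
by rewrite [RHS]big_nat_recl // bin0 mul1r.
Qed.

(** [2 ^+ L] times the r-th moment of a sum of [L] independent random signs. *)
Definition bin_moment (R : realType) (r L : nat) : R :=
  \sum_(0 <= J < L.+1) 'C(L, J)%:R * (2 * J%:R - L%:R) ^+ r.

Lemma bin_moment_step (R : realType) (r L : nat) :
  bin_moment R r L.+1 = \sum_(0 <= J < L.+1) 'C(L, J)%:R *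
    ((2 * J%:R - L%:R - 1) ^+ r + (2 * J%:R - L%:R + 1) ^+ r).
Proof.
rewrite /bin_moment sum_bin_step; apply: eq_bigr => J _.
by congr (_ * (_ ^+ r + _ ^+ r)); rewrite -!natr1; ring.
Qed.

(** The constants 3, 15, 105 are moments of the normal law. With them the induction closes, since
    the lower order terms of the recurrences fit in the binomial expansion, as in 3L^2 + 6L + 1 <=
    3(L + 1)^2. *)
Lemma bin_moments (R : realType) (L : nat) :
  [/\ bin_moment R 0 L = 2 ^+ L,
      bin_moment R 2 L = L%:R * 2 ^+ L,
      bin_moment R 4 L <= 3 * L%:R ^+ 2 * 2 ^+ L,
      bin_moment R 6 L <= 15 * L%:R ^+ 3 * 2 ^+ L &
      bin_moment R 8 L <= 105 * L%:R ^+ 4 * 2 ^+ L].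
Proof.
elim: L => [|L [m0 m2 m4 m6 m8]].
  have e r : bin_moment R r 0 = 0 ^+ r.
    by rewrite /bin_moment big_nat1 bin0 mul1r mulr0 subr0.
  by rewrite !e !expr0n /= !mulr0 !mul0r; split.
have s0 : bin_moment R 0 L.+1 = 2 * bin_moment R 0 L.
  rewrite bin_moment_step /bin_moment mulr_sumr.
  by apply: eq_bigr => J _; rewrite !expr0; ring.
have s2 : bin_moment R 2 L.+1 = 2 * (bin_moment R 2 L + bin_moment R 0 L).
  rewrite bin_moment_step /bin_moment -big_split mulr_sumr /=.
  by apply: eq_bigr => J _; rewrite !expr0; ring.
have s4 : bin_moment R 4 L.+1 =
    2 * (bin_moment R 4 L + 6 * bin_moment R 2 L + bin_moment R 0 L).
  rewrite bin_moment_step /bin_moment !mulr_sumr -!big_split mulr_sumr /=.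
  by apply: eq_bigr => J _; rewrite !expr0; ring.
have s6 : bin_moment R 6 L.+1 =
    2 * (bin_moment R 6 L + 15 * bin_moment R 4 L + 15 * bin_moment R 2 L
         + bin_moment R 0 L).
  rewrite bin_moment_step /bin_moment !mulr_sumr -!big_split mulr_sumr /=.
  by apply: eq_bigr => J _; rewrite !expr0; ring.
have s8 : bin_moment R 8 L.+1 =
    2 * (bin_moment R 8 L + 28 * bin_moment R 6 L + 70 * bin_moment R 4 L
         + 28 * bin_moment R 2 L + bin_moment R 0 L).
  rewrite bin_moment_step /bin_moment !mulr_sumr -!big_split mulr_sumr /=.
  by apply: eq_bigr => J _; rewrite !expr0; ring.
rewrite s0 s2 s4 s6 s8 m0 m2 -[L.+1%:R]natr1 exprS.
have E0 : 0 < 2 ^+ L :> R by rewrite exprn_gt0.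
have x0 : 0 <= L%:R :> R by [].
move: (2 ^+ L) E0 (L%:R : R) x0 (bin_moment R 4 L) (bin_moment R 6 L)
  (bin_moment R 8 L) m4 m6 m8 => E E0 x x0 a b c ha hb hc.
have xE : 0 <= x * E by rewrite mulr_ge0// ltW.
have x2E : 0 <= x ^+ 2 * E by rewrite mulr_ge0 ?exprn_ge0// ltW.
have x3E : 0 <= x ^+ 3 * E by rewrite mulr_ge0 ?exprn_ge0// ltW.
split; [by []|by ring|lra|lra|lra].
Qed.

Lemma abel_tail (R : realType) (k B : nat) (g : nat -> R) : g B = 0 ->
  \sum_(0 <= j < B) 'C(j + k.+1, k.+1)%:R * (g j.+1 - g j) =
  - \sum_(0 <= j < B) 'C(j + k, k)%:R * g j.
Proof.
move=> gB.
suff main b : \sum_(0 <= j < b) 'C(j + k.+1, k.+1)%:R * (g j.+1 - g j) =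
    'C(b + k, k.+1)%:R * g b - \sum_(0 <= j < b) 'C(j + k, k)%:R * g j.
  by rewrite main gB mulr0 sub0r.
elim: b => [|b IH]; first by rewrite !big_geq // bin_small // mul0r subr0.
rewrite !big_nat_recr //= IH addSn addnS [in X in X * (_ - _)]binS [in RHS]binS natrD.
by ring.
Qed.

(* Summation by parts four times. *)
Lemma newton_tail (R : realType) (B : nat) (w : nat -> R) :
  (forall j, (B <= j)%N -> w j = 0) ->
  \sum_(0 <= j < B) 'C(j + 3, 3)%:R
    * (w j.+4 - 4 * w j.+3 + 6 * w j.+2 - 4 * w j.+1 + w j) = w 0%N.
Proof.
move=> w0.
pose d (f : nat -> R) j := f j.+1 - f j.
have d0 f : (forall j, (B <= j)%N -> f j = 0) -> (forall j, (B <= j)%N -> d f j = 0).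
  by move=> f0 j Bj; rewrite /d !f0 ?subrr // ltnW.
transitivity (\sum_(0 <= j < B) 'C(j + 3, 3)%:R * d (d (d (d w))) j).
  by apply: eq_bigr => j _; rewrite /d; congr (_ * _); ring.
have step k f : (forall j, (B <= j)%N -> f j = 0) ->
    \sum_(0 <= j < B) 'C(j + k.+1, k.+1)%:R * d f j =
    - \sum_(0 <= j < B) 'C(j + k, k)%:R * f j.
  by move=> f0; apply: abel_tail; exact: f0.
have d1 := d0 _ w0; have d2 := d0 _ d1; have d3 := d0 _ d2.
rewrite step // step // step // !opprK.
rewrite (eq_bigr (d w)) => [|j _]; last by rewrite addn0 bin0 mul1r.
by rewrite telescope_sumr // w0 // sub0r opprK.
Qed.

(** Truncated subtraction makes this the sixth difference only for [6 <= p]. *)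
Definition bin_diff6 (R : realType) (m p : nat) : R :=
  'C(m, p)%:R - 6 * 'C(m, p - 1)%:R + 15 * 'C(m, p - 2)%:R
  - 20 * 'C(m, p - 3)%:R + 15 * 'C(m, p - 4)%:R - 6 * 'C(m, p - 5)%:R
  + 'C(m, p - 6)%:R.

Lemma bin_shift6 (R : realType) (m p s : nat) : (s <= 6)%N -> (6 <= p)%N ->
  'C(m, p - s)%:R * \prod_(1 <= l < 7) (m%:R + l%:R) =
  'C(m + 6, p)%:R * (\prod_(1 <= l < s.+1) (p%:R - s%:R + l%:R)
   * \prod_(1 <= l < (6 - s).+1) (m%:R - p%:R + s%:R + l%:R)) :> R.
Proof.
move=> s6 p6; have := bin_shift R m (p - s) s (6 - s).
rewrite -addnA subnK; last by lia.
rewrite subnKC // => ->; rewrite natrB; last by lia.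
rewrite -mulrA; congr (_ * (_ * _)); apply: eq_bigr => l _; ring.
Qed.

(** With x of weight 2 and y of weight 1, the part of weight 6 is x^3 H_6(y / sqrt x) with H_6 the
    Hermite polynomial, as the Gaussian approximation exp(-y^2/x) predicts; the other terms have
    lower weight. *)
Lemma bin_diff6E (R : realType) (n k : nat) : (3 <= n)%N ->
  bin_diff6 R n.*2 (n + 3 + k) * \prod_(1 <= l < 7) (n.*2%:R + l%:R) =
  'C((n + 3).*2, n + 3 + k)%:R *
  (let x := n%:R in let y := k%:R in
   64 * y ^+ 6 - 480 * x * y ^+ 4 + 720 * x ^+ 2 * y ^+ 2 - 800 * y ^+ 4
   + 2640 * x * y ^+ 2 - 120 * x ^+ 3 - 720 * x ^+ 2 + 2176 * y ^+ 2
   - 1320 * x - 720).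
Proof.
move=> n3; have p6 : (6 <= n + 3 + k)%N by lia.
rewrite (_ : (n + 3).*2 = n.*2 + 6)%N; last by lia.
set p := (n + 3 + k)%N in p6 *.
have b s (s6 : (s <= 6)%N) := bin_shift6 R n.*2 p s s6 p6.
move: b; set P := \prod_(1 <= l < 7) _; move: P => P b.
have b0 := b 0%N isT; have b1 := b 1%N isT; have b2 := b 2%N isT.
have b3 := b 3%N isT; have b4 := b 4%N isT; have b5 := b 5%N isT.
have b6 := b 6%N isT; rewrite subn0 in b0.
have distr (c0 c1 c2 c3 c4 c5 c6 : R) :
    (c0 - 6 * c1 + 15 * c2 - 20 * c3 + 15 * c4 - 6 * c5 + c6) * P =
    c0 * P - 6 * (c1 * P) + 15 * (c2 * P) - 20 * (c3 * P) + 15 * (c4 * P)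
    - 6 * (c5 * P) + c6 * P by ring.
rewrite /bin_diff6 distr b0 b1 b2 b3 b4 b5 b6.
rewrite /index_iota /= !big_cons !big_nil /=.
have -> : p%:R = n%:R + 3 + k%:R :> R by rewrite /p !natrD.
have -> : n.*2%:R = 2 * n%:R :> R by rewrite -mul2n natrM.
move: (n%:R : R) (k%:R : R) ('C(n.*2 + 6, p)%:R : R) => x y c.
ring.
Qed.

Lemma bin_diff6_le (R : realType) (n k : nat) : (3 <= n)%N ->
  `|bin_diff6 R n.*2 (n + 3 + k)| <=
  100 * 100 * 'C((n + 3).*2, n + 3 + k)%:R * (k%:R ^+ 6 + n%:R ^+ 3) / n%:R ^+ 6.
Proof.
move=> n3; have := bin_diff6E R n k n3 => /=.
have x1 : 1 <= n%:R :> R by rewrite ler1n; lia.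
have y0 : 0 <= k%:R :> R by [].
have c0 : 0 <= 'C((n + 3).*2, n + 3 + k)%:R :> R by [].
have : n%:R ^+ 6 <= \prod_(1 <= l < 7) (n.*2%:R + l%:R) :> R.
  rewrite -[leLHS](_ : \prod_(1 <= l < 7) n%:R = _); last first.
    by rewrite /index_iota /= !big_cons !big_nil; ring.
  by apply: ler_prod => l _; rewrite ler0n -natrD ler_nat; lia.
move: (\prod_(1 <= l < 7) _) (bin_diff6 R _ _) ('C(_, _)%:R) (n%:R : R) (k%:R : R) x1 y0 c0.
move=> P D C x y x1 y0 C0 xP e.
have x6 : 0 < x ^+ 6 by rewrite exprn_gt0//; lra.
rewrite ler_pdivlMr//.
apply: (@le_trans _ _ (`|D| * P)); first by rewrite ler_wpM2l.
have P0 : 0 < P by lra.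
rewrite -[X in _ * X <= _](ger0_norm (ltW P0)) -normrM e normrM ger0_norm//.
rewrite [leRHS]mulrAC mulrC ler_wpM2r//.
have y2 : 0 <= y ^+ 2 by rewrite exprn_ge0.
have x0 : 0 <= x by lra.
(* This bounds the mixed monomials of weight 6 by [x ^+ 3 + y ^+ 6], and [1 <= x] lifts those of
   lower weight. The absolute coefficients add up to 9760, below [100 * 100]. *)
have am (u v : R) : 0 <= u -> 0 <= v -> u * v ^+ 2 <= u ^+ 3 + v ^+ 3 /\
    u ^+ 2 * v <= u ^+ 3 + v ^+ 3.
  move=> u0 v0; have u3 : 0 <= u ^+ 3 by rewrite exprn_ge0.
  have v3 : 0 <= v ^+ 3 by rewrite exprn_ge0.
  have [uv|/ltW vu] := leP u v.
    have h : u * v ^+ 2 <= v ^+ 3 by rewrite [v ^+ 3]exprS ler_wpM2r ?exprn_ge0.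
    have h' : u ^+ 2 * v <= v ^+ 3 by rewrite [v ^+ 3]exprSr ler_wpM2r// lerXn2r.
    by split; lra.
  have h : u * v ^+ 2 <= u ^+ 3 by rewrite [u ^+ 3]exprS ler_wpM2l// lerXn2r.
  have h' : u ^+ 2 * v <= u ^+ 3 by rewrite [u ^+ 3]exprSr ler_wpM2l ?exprn_ge0.
  by split; lra.
have e6 : y ^+ 6 = (y ^+ 2) ^+ 3 by rewrite -exprM.
have e4 : y ^+ 4 = (y ^+ 2) ^+ 2 by rewrite -exprM.
rewrite e6 e4; move: (y ^+ 2) y2 => z z0.
have [a1 a2] := am x z x0 z0.
have xx : x <= x ^+ 2 by rewrite -[leLHS]expr1 ler_weXn2l.
have xxx : x ^+ 2 <= x ^+ 3 by rewrite ler_weXn2l.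
have b1 : z ^+ 2 <= x * z ^+ 2 by rewrite ler_peMl ?exprn_ge0.
have b2 : x * z <= x ^+ 2 * z by rewrite ler_wpM2r.
have b3 : z <= x * z by rewrite ler_peMl.
have z3 : 0 <= z ^+ 3 by rewrite exprn_ge0.
have z2 : 0 <= z ^+ 2 by rewrite exprn_ge0.
have zx : 0 <= x * z by rewrite mulr_ge0.
clear e am e6 e4 xP x6 P0.
rewrite ler_norml; apply/andP; split.
  lra.
lra.
Qed.

Lemma sum_shifted_le (R : realType) (f : nat -> R) (a b L : nat) :
  (forall J, 0 <= f J) -> (forall J, (L < J)%N -> f J = 0) ->
  \sum_(a <= J < b) f J <= \sum_(0 <= J < L.+1) f J.
Proof.
move=> f0 fL; have [ba|ab] := leqP b a; first by rewrite big_geq // sumr_ge0.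
apply: (@le_trans _ _ (\sum_(0 <= J < b + L.+1) f J)).
  rewrite (@big_cat_nat _ _ _ b 0) //=; last by rewrite leq_addr.
  rewrite (@big_cat_nat _ _ _ a 0 b) //=; last by rewrite ltnW.
  have h1 : 0 <= \sum_(0 <= J < a) f J by apply: sumr_ge0.
  have h2 : 0 <= \sum_(b <= J < b + L.+1) f J by apply: sumr_ge0.
  by lra.
rewrite (@big_cat_nat _ _ _ L.+1 0) //=; last by rewrite leq_addl.
rewrite [X in _ + X]big_nat [X in _ + X]big1 ?addr0 // => J /andP[LJ _].
exact: fL.
Qed.

(** With J = m + Y + 1 one has 2J - 2m = 2(Y + 1), whence the factor [2 ^+ r]; as [r] is even,
    completing the row adds only nonnegative terms. *)
Lemma sum_bin_pow_le (R : realType) (m r D : nat) : ~~ odd r ->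
  \sum_(1 <= Y < D) 'C(m.*2, m + Y.+1)%:R * Y.+1%:R ^+ r <=
  bin_moment R r m.*2 / 2 ^+ r.
Proof.
move=> er; rewrite ler_pdivlMr ?exprn_gt0 // mulr_suml.
rewrite (eq_bigr (fun Y => 'C(m.*2, Y + m.+1)%:R
    * (2 * (Y + m.+1)%:R - m.*2%:R) ^+ r)) => [|Y _]; last first.
  rewrite -mulrA -exprMn addnS -addSn addnC; congr (_ * _ ^+ r).
  by rewrite natrD -mul2n natrM; ring.
have -> : \sum_(1 <= Y < D) 'C(m.*2, Y + m.+1)%:R
      * (2 * (Y + m.+1)%:R - m.*2%:R) ^+ r =
    \sum_(1 + m.+1 <= J < D + m.+1) 'C(m.*2, J)%:R * (2 * J%:R - m.*2%:R) ^+ r :> R.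
  by rewrite big_addn addnK.
apply: sum_shifted_le => J; first by rewrite mulr_ge0 // exprn_even_ge0.
by move=> mJ; rewrite bin_small // mul0r.
Qed.

(** Weighting k^6 + n^3 by a square calls for the moments of order 8 and 2, of size n^4 and n times
    4^n, so division by n^6 leaves n^(-2). The factor 4 comes from [Y.+2 <= 2 * Y.+1];
    [m.*2 <= 4 * n] and [2 ^+ m.*2 = 64 * 4 ^+ n] give [105 * 256 * 64] and 4 times 64. *)
Lemma sum_bin_diff6_le (R : realType) (n D : nat) : (3 <= n)%N ->
  \sum_(1 <= Y < D) `|bin_diff6 R n.*2 (n + 3 + Y.+1)| * Y.+2%:R ^+ 2 <=
  4 * (100 * 100) * (105 * 256 * 64 + 256) * (4 ^+ n / n%:R ^+ 2).
Proof.
move=> n3; set m := (n + 3)%N.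
have x3 : 3 <= n%:R :> R by rewrite ler_nat.
have x0 : 0 < n%:R :> R by lra.
have xp k : 0 < n%:R ^+ k :> R by rewrite exprn_gt0.
pose S r := \sum_(1 <= Y < D) 'C(m.*2, m + Y.+1)%:R * Y.+1%:R ^+ r : R.
have S8 : S 8%N <= bin_moment R 8 m.*2 / 2 ^+ 8 by apply: sum_bin_pow_le.
have S2 : S 2%N <= bin_moment R 2 m.*2 / 2 ^+ 2 by apply: sum_bin_pow_le.
have main : \sum_(1 <= Y < D) `|bin_diff6 R n.*2 (n + 3 + Y.+1)| * Y.+2%:R ^+ 2
    <= 4 * (100 * 100) / n%:R ^+ 6 * (S 8%N + n%:R ^+ 3 * S 2%N).
  rewrite /S mulr_sumr -big_split mulr_sumr /=; apply: ler_sum => Y _.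
  have y1 : 1 <= Y.+1%:R :> R by rewrite ler1n.
  have yy : Y.+2%:R ^+ 2 <= 4 * Y.+1%:R ^+ 2 :> R.
    have -> : 4 * Y.+1%:R ^+ 2 = (2 * Y.+1%:R) ^+ 2 :> R by ring.
    by rewrite lerXn2r ?nnegrE -?natrM // ler_nat; lia.
  apply: (le_trans (ler_pM _ _ (bin_diff6_le R n Y.+1 n3) yy)) => //.
  rewrite le_eqVlt; apply/orP; left; apply/eqP.
  rewrite -/m; move: ('C(_, _)%:R : R) (Y.+1%:R : R) => c y.
  by field; rewrite gt_eqF.
apply: (le_trans main).
have [_ m2 _ _ m8] := bin_moments R m.*2.
rewrite m2 in S2.
have E : 2 ^+ m.*2 = 64 * 4 ^+ n :> R.
  rewrite /m -mul2n exprM exprD mulrC; congr (_ * _); [by ring|].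
  by congr (_ ^+ n); ring.
have mx : m.*2%:R <= 4 * n%:R :> R by rewrite -natrM ler_nat /m; lia.
have F0 : 0 < 4 ^+ n :> R by rewrite exprn_gt0.
have h8 : S 8%N <= 105 * (4 * n%:R) ^+ 4 * (64 * 4 ^+ n).
  apply: (@le_trans _ _ (bin_moment R 8 m.*2)).
    apply: (le_trans S8); rewrite ler_pdivrMr ?exprn_gt0 // ler_peMr //.
      rewrite /bin_moment sumr_ge0 // => J _.
      by rewrite mulr_ge0 // exprn_even_ge0.
    by rewrite exprn_ege1 // ler1n.
  apply: (le_trans m8); rewrite E; apply: ler_wpM2r.
    by apply: mulr_ge0 => //; exact: ltW.
  apply: ler_wpM2l => //.
  by rewrite lerXn2r ?nnegrE // mulr_ge0.
have h2 : S 2%N <= 4 * n%:R * (64 * 4 ^+ n).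
  apply: (le_trans S2); rewrite E ler_pdivrMr ?exprn_gt0 //.
  have q0 : 0 <= 64 * 4 ^+ n :> R by apply: mulr_ge0 => //; exact: ltW.
  apply: (@le_trans _ _ (4 * n%:R * (64 * 4 ^+ n))); first exact: ler_wpM2r.
  have q1 : 0 <= 4 * n%:R * (64 * 4 ^+ n) :> R by rewrite mulr_ge0 // mulr_ge0.
  by rewrite expr2; move: (4 * n%:R * (64 * 4 ^+ n)) q1 => q q1; lra.
apply: (@le_trans _ _ (4 * (100 * 100) / n%:R ^+ 6 *
  (105 * (4 * n%:R) ^+ 4 * (64 * 4 ^+ n) + n%:R ^+ 3 * (4 * n%:R * (64 * 4 ^+ n))))).
  rewrite ler_wpM2l ?divr_ge0 ?exprn_ge0 // lerD // ler_wpM2l // exprn_ge0 //.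
rewrite le_eqVlt; apply/orP; left; apply/eqP.
move: (100 : R) (105 : R) => c d.
by field; rewrite gt_eqF.
Qed.

(** * The average number of weak left to right maxima *)

Lemma cwalk_binR (R : realType) (n J : nat) :
  (cwalk n (J%:Z - n%:Z))%:~R = 'C(n.*2, J)%:R :> R.
Proof.
rewrite /cwalk (_ : (J%:Z - n%:Z) *+ 2 = J%:Z *+ 2 - n.*2%:Z); last by lia.
by rewrite walk_bin rmorph_nat.
Qed.

(** The weight (n + 1) s(N - 1) / c(0) of the overview, by [cdiff2_beta]. *)
Definition vbeta (R : realType) (n N : nat) : R := beta R n N.-1 - beta R n N.

Lemma betaE (R : realType) (n N : nat) :
  cbin R n * beta R n N =
  n.+1%:R * ((cwalk n (N%:Z - 1))%:~R - (cwalk n N%:Z)%:~R).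
Proof.
have c0 := lt0r_neq0 (cbin_gt0 R n).
have m0 : n.*2.+1%:R != 0 :> R by rewrite pnatr_eq0.
case: N => [|N].
  have -> : cwalk n (0%N%:Z - 1) = cwalk n 1%N%:Z by rewrite -cwalkN; congr (cwalk n _); lia.
  rewrite beta0 !cwalk_bin addn0 addn1.
  have h := congr1 (fun k => k%:R : R) (mul_bin_left n.*2 n).
  rewrite /= !natrM (_ : n.*2 - n = n)%N in h; last by lia.
  rewrite !rmorph_nat mulrBr h /cbin -natr1; ring.
rewrite [N.+1%:Z - 1](_ : _ = N%:Z); last by lia.
rewrite !cwalk_bin !rmorph_nat /beta /rho.
have h1 := congr1 (fun k => k%:R : R) (mul_bin_diag n.*2.+1 (n + N)).
have h2 := bin_downR R n.*2 (n + N.+1).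
rewrite /= !natrM in h1; rewrite addnS in h2 *.
have -> : cbin R n * ((2 * N.+1%:R - 1) * ('C(n.*2.+1, (n + N).+1)%:R
    * (n.+1%:R / (n.*2.+1%:R * cbin R n)))) =
  n.+1%:R * ((2 * N.+1%:R - 1) * 'C(n.*2.+1, (n + N).+1)%:R / n.*2.+1%:R).
  have cancel (c u v w z : R) : c != 0 -> z != 0 ->
      c * (u * (v * (w / (z * c)))) = w * (u * v / z).
    by move=> c1 z1; field; rewrite c1 z1.
  exact: cancel.
congr (_ * _); apply: (mulIf m0); rewrite divfK //.
have e1 : n.*2%:R + 1 = n.*2.+1%:R :> R by rewrite natr1.
rewrite [LHS]mulrC in h1; rewrite {1}e1 in h2.
rewrite [RHS]mulrBl h1 h2 -[(n + N).+1%:R]natr1 -[N.+1%:R]natr1 natrD -mul2n natrM.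
ring.
Qed.

Lemma cdiff2_beta (R : realType) (n N : nat) : (0 < N)%N ->
  n.+1%:R * (cdiff2 n (N%:Z - 1))%:~R = cbin R n * vbeta R n N.
Proof.
case: N => // N _; rewrite /vbeta mulrBr !betaE /cdiff2 !rmorphD rmorphN rmorphMn /=.
rewrite [N.+1%:Z - 1](_ : _ = N%:Z); last by lia.
rewrite [N%:Z + 1](_ : _ = N.+1%:Z); last by lia.
ring.
Qed.

Lemma sum_cdiff2_all (n B : nat) : (n.+1 < B)%N ->
  \sum_(1 <= b < B.+1) cdiff2 n (b%:Z - 1) = cwalk n 1 - cwalk n 0.
Proof.
move=> nB; pose g (b : nat) := cwalk n b%:Z - cwalk n (b%:Z - 1).
rewrite big_add1 /= (eq_bigr (fun b => g b.+1 - g b)) => [|b _]; last first.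
  rewrite /g /cdiff2 [b.+1%:Z - 1](_ : _ = b%:Z); last by lia.
  by rewrite [b%:Z + 1](_ : _ = b.+1%:Z); lia.
rewrite telescope_sumr // /g sub0r cwalkN.
rewrite (cwalk_out n B%:Z); last by lia.
rewrite (cwalk_out n (B%:Z - 1)); last by lia.
by rewrite subrr sub0r opprB.
Qed.

(** In terms of the row 2n + 1, c(k) = w(k - 1) + w(k); second differences at odd arguments then
    telescope with step 2, and the term at 0 vanishes because w(-1) = w(0). *)
Lemma sum_cdiff2_even (n B : nat) : (n < B)%N ->
  \sum_(1 <= b < B.+1) cdiff2 n.+1 (2 * b%:Z - 1) = 0.
Proof.
move=> nB; pose w (k : int) := walk n.*2.+1 (k *+ 2 + 1).
have cE k : cwalk n.+1 k = w (k - 1) + w k.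
  rewrite /cwalk /w doubleS [LHS]/=; congr (walk n.*2.+1 _ + walk n.*2.+1 _); lia.
pose g (b : nat) := w (2 * b%:Z) - w (2 * b%:Z - 1).
rewrite big_add1 /= (eq_bigr (fun b => g b.+1 - g b)) => [|b _]; last first.
  rewrite /g /cdiff2 !cE.
  rewrite [2 * b.+1%:Z - 1 + 1 - 1](_ : _ = 2 * b.+1%:Z - 1); last by lia.
  rewrite [2 * b.+1%:Z - 1 + 1](_ : _ = 2 * b.+1%:Z); last by lia.
  rewrite [2 * b.+1%:Z - 1 - 1](_ : _ = 2 * b%:Z); last by lia.
  by ring.
rewrite telescope_sumr // /g /w.
rewrite [walk _ (_ *+ 2 + 1)]walk_out; last by lia.
rewrite [walk _ ((2 * B%:Z - 1) *+ 2 + 1)]walk_out; last by lia.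
rewrite subrr sub0r; apply/eqP; rewrite oppr_eq0 subr_eq0; apply/eqP.
by rewrite -walkN; congr (walk _ _); lia.
Qed.

(** The rows a = 1 and a = 2 complete the sum to all divisors. The second is zero and the first is
    minus the number of Dyck paths, which the leading 1 compensates. *)
Lemma nu_eq (R : realType) (n : nat) :
  nu R n.+1 = 1 + \sum_(1 <= a < n.*2.+4) \sum_(1 <= b < n.*2.+4)
    vbeta R n.+1 (a * b).
Proof.
have c0 := lt0r_neq0 (cbin_gt0 R n.+1).
have n2 : n.+2%:R != 0 :> R by rewrite pnatr_eq0.
have cat : (cwalk n.+1 0 - cwalk n.+1 1)%:~R = cbin R n.+1 / n.+2%:R :> R.
  have := betaE R n.+1 0.
  have -> : cwalk n.+1 (0%N%:Z - 1) = cwalk n.+1 1 by rewrite -cwalkN; congr (cwalk _ _); lia.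
  rewrite beta0 mulrN1 rmorphB /= => h.
  apply: (mulfI n2); rewrite [RHS]mulrCA divff // mulr1.
  by rewrite -[RHS]opprK h -mulrN opprB.
have E : \sum_(1 <= a < n.*2.+4) \sum_(1 <= b < n.*2.+4) cdiff2 n.+1 ((a * b)%N%:Z - 1) =
   (\sum_(p in Dyck n.+1) num_weak_lr_max p)%N%:R - (cwalk n.+1 0 - cwalk n.+1 1).
  rewrite big_ltn // big_ltn // opprB.
  rewrite [X in X + _ = _](_ : _ = \sum_(1 <= b < n.*2.+4) cdiff2 n.+1 (b%:Z - 1));
    last by apply: eq_bigr => b _; rewrite mul1n.
  rewrite sum_cdiff2_all; last by lia.
  rewrite [X in _ + (X + _)](_ : _ = 0) ?add0r; last first.
    rewrite -[RHS](sum_cdiff2_even n n.*2.+3); last by lia.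
    by apply: eq_bigr => b _; congr (cdiff2 _ _); lia.
  rewrite addrC; congr (_ + _).
  rewrite (sum_weak_lr_max_cdiff2 n n.*2.+3); last by lia.
  rewrite -[3%N]/(0 + 3)%N big_addn (_ : n.*2.+4 - 3 = n.*2.+1)%N; last by lia.
  apply: eq_bigr => d _; rewrite big_add1 /=; apply: eq_bigr => j _.
  by congr (cdiff2 _ _); lia.
rewrite /nu.
have -> : (#|Dyck n.+1|%:R : R) = cbin R n.+1 / n.+2%:R.
  by rewrite -cat -card_Dyck rmorph_nat.
have -> : (\sum_(p in Dyck n.+1) num_weak_lr_max p)%N%:R =
  (\sum_(1 <= a < n.*2.+4) \sum_(1 <= b < n.*2.+4)
    cdiff2 n.+1 ((a * b)%N%:Z - 1))%:~R + cbin R n.+1 / n.+2%:R :> R.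
  by rewrite E rmorphB /= rmorph_nat cat subrK.
rewrite mulrDl divff ?mulf_neq0 ?invr_eq0 // addrC; congr (_ + _).
rewrite rmorph_sum mulr_suml !big_nat; apply: eq_bigr => a /andP[a0 _].
rewrite rmorph_sum mulr_suml !big_nat; apply: eq_bigr => b /andP[b0 _].
have := cdiff2_beta R n.+1 (a * b); rewrite muln_gt0 a0 b0 => /(_ isT) h.
have cancel (c u v z : R) : c != 0 -> z != 0 -> z * u = c * v ->
    u * (c / z)^-1 = v.
  by move=> c1 z1 e; rewrite invf_div mulrCA mulrA e mulrAC divff ?mul1r.
exact: cancel.
Qed.

Lemma vbeta_out (R : realType) (n N : nat) : (n.+2 < N)%N -> vbeta R n N = 0.
Proof.
move=> nN; rewrite /vbeta /beta !rho_out ?mulr0 ?subrr //; first by lia.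
by lia.
Qed.

Lemma vbeta_bin (R : realType) (n N : nat) : (0 < n)%N -> (0 < N)%N ->
  cbin R n * vbeta R n N = n.+1%:R *
   ('C(n.*2, n + N)%:R - 2 * 'C(n.*2, n + N - 1)%:R + 'C(n.*2, n + N - 2)%:R).
Proof.
move=> n0 N0; rewrite -cdiff2_beta // -!cwalk_binR; congr (_ * _).
rewrite /cdiff2 !rmorphD rmorphN rmorphMn /= -mulr_natl.
by congr ((cwalk _ _)%:~R - _ * (cwalk _ _)%:~R + (cwalk _ _)%:~R); lia.
Qed.

Definition vdiff4 (R : realType) (n Y : nat) : R :=
  vbeta R n Y.+4 - 4 * vbeta R n Y.+3 + 6 * vbeta R n Y.+2 - 4 * vbeta R n Y.+1
  + vbeta R n Y.

Lemma vdiff4_bin (R : realType) (n Y : nat) : (0 < n)%N -> (0 < Y)%N ->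
  cbin R n * vdiff4 R n Y = n.+1%:R * bin_diff6 R n.*2 (n + 3 + Y.+1).
Proof.
move=> n0 Y0.
have distr (a b c d e : R) : cbin R n * (a - 4 * b + 6 * c - 4 * d + e) =
  cbin R n * a - 4 * (cbin R n * b) + 6 * (cbin R n * c) - 4 * (cbin R n * d)
  + cbin R n * e by ring.
rewrite /vdiff4 distr !vbeta_bin // /bin_diff6.
have [q qE] : exists q, (n + Y = q.+2)%N by exists (n + Y).-2; lia.
have e0 : (n + 3 + Y.+1 = q.+4.+2)%N by lia.
have e1 i : (n + (i + Y) = (i + q).+2)%N by lia.
rewrite e0 (e1 4) (e1 3) (e1 2) (e1 1%N) (e1 0%N).
rewrite ?addSn ?add0n ?subSS ?subn0.
ring.
Qed.

(** The weight becomes a superposition of truncated kernels in [N], so that summing any function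
    against it brings out its fourfold iterated sums at X = Y + 2. [D] only has to pass the support
    of [vbeta]. *)
Lemma vbeta_newton (R : realType) (n N D : nat) : (0 < N)%N -> (n.+2 < D)%N ->
  vbeta R n N = \sum_(1 <= Y < D) 'C(Y.+3 - N, 3)%:R * vdiff4 R n Y.
Proof.
move=> N0 nD; have [DN|ND] := leqP D N.
  rewrite vbeta_out; last by lia.
  rewrite big_nat big1 // => Y /andP[_ YD]; rewrite bin_small ?mul0r //; lia.
rewrite (@big_cat_nat _ _ _ N) //=; last by rewrite ltnW.
rewrite big_nat big1 ?add0r => [|Y /andP[_ YN]]; last first.
  by rewrite bin_small ?mul0r //; lia.
have w0 j : (D - N <= j)%N -> vbeta R n (N + j) = 0.
  by move=> Dj; rewrite vbeta_out //; lia.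
have := newton_tail R (D - N) (fun j => vbeta R n (N + j)) w0.
rewrite addn0 => <-.
rewrite [RHS](_ : _ = \sum_(0 + N <= Y < D) 'C(Y.+3 - N, 3)%:R * vdiff4 R n Y) //.
rewrite big_addn.
apply: eq_bigr => j _; rewrite /vdiff4 !addnS [(j + N)%N]addnC.
by congr ('C(_, _)%:R * _); lia.
Qed.

Lemma sum_model_trunc (R : realType) (m : nat -> R) (Y L : nat) : (Y < L)%N ->
  \sum_(1 <= N < L) m N * 'C(Y.+3 - N, 3)%:R =
  \sum_(1 <= N < Y.+1) m N * 'C(Y.+3 - N, 3)%:R.
Proof.
move=> YL; rewrite (@big_cat_nat _ _ _ Y.+1) //= [X in _ + X]big_nat.
rewrite [X in _ + X]big1 ?addr0 // => N /andP[YN _].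
by rewrite bin_small ?mulr0 //; lia.
Qed.

(** Both sums become fourfold sums against the same [vdiff4]; their difference is at most
    [30 * Y.+2%:R ^+ 2] by [div_sum_model_le], and [sum_bin_diff6_le] adds these errors up. *)
Lemma vbeta_sum_model_le (R : realType) (n : nat) : (3 <= n)%N ->
  `|\sum_(1 <= a < n.*2.+2) \sum_(1 <= b < n.*2.+2) vbeta R n (a * b)
    - \sum_(1 <= N < n.*2.+2) div_model R N * vbeta R n N| <=
  n.+1%:R / cbin R n * (30 *
    (4 * (100 * 100) * (105 * 256 * 64 + 256) * (4 ^+ n / n%:R ^+ 2))).
Proof.
move=> n3; have c0 := cbin_gt0 R n.
have -> : \sum_(1 <= a < n.*2.+2) \sum_(1 <= b < n.*2.+2) vbeta R n (a * b) =
    \sum_(1 <= Y < n.*2) vdiff4 R n Y * div_sum R n.*2.+1 Y.+2.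
  under [RHS]eq_bigr do rewrite mulr_sumr.
  rewrite [RHS]exchange_big /= !big_nat; apply: eq_bigr => a /andP[a0 _].
  under [RHS]eq_bigr do rewrite mulr_sumr.
  rewrite [RHS]exchange_big /= !big_nat; apply: eq_bigr => b /andP[b0 _].
  rewrite (@vbeta_newton R n (a * b) n.*2); [|by rewrite muln_gt0 a0|by lia].
  by apply: eq_bigr => Y _; rewrite mulrC.
have -> : \sum_(1 <= N < n.*2.+2) div_model R N * vbeta R n N =
    \sum_(1 <= Y < n.*2) vdiff4 R n Y *
      \sum_(1 <= N < Y.+4) div_model R N * 'C(Y.+3 - N, 3)%:R.
  transitivity (\sum_(1 <= Y < n.*2) vdiff4 R n Y *
      \sum_(1 <= N < n.*2.+2) div_model R N * 'C(Y.+3 - N, 3)%:R); last first.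
    apply: eq_big_nat => Y /andP[_ Yn]; congr (_ * _).
    by rewrite !(sum_model_trunc R _ Y) //; lia.
  under [RHS]eq_bigr do rewrite mulr_sumr.
  rewrite [RHS]exchange_big /= !big_nat; apply: eq_bigr => N /andP[N0 _].
  rewrite (@vbeta_newton R n N n.*2) //; last by lia.
  by rewrite mulr_sumr; apply: eq_bigr => Y _; rewrite mulrCA mulrC -mulrA [in RHS]mulrCA.
rewrite -sumrB; apply: (le_trans (ler_norm_sum _ _ _)).
have h := sum_bin_diff6_le R n n.*2 n3.
have nc0 : 0 <= n.+1%:R / cbin R n by rewrite divr_ge0 // ltW.
apply: (@le_trans _ _ (n.+1%:R / cbin R n * (30 *
  \sum_(1 <= Y < n.*2) `|bin_diff6 R n.*2 (n + 3 + Y.+1)| * Y.+2%:R ^+ 2))); last first.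
  by apply: ler_wpM2l => //; apply: ler_wpM2l.
rewrite !mulr_sumr !big_nat; apply: ler_sum => Y /andP[Y0 Yn].
rewrite -mulrBr normrM.
have -> : vdiff4 R n Y = n.+1%:R / cbin R n * bin_diff6 R n.*2 (n + 3 + Y.+1).
  apply: (mulfI (lt0r_neq0 c0)); rewrite vdiff4_bin //; last by lia.
  by rewrite mulrA [cbin R n * _]mulrC divfK // gt_eqF.
rewrite normrM (ger0_norm nc0) -mulrA; apply: ler_wpM2l => //.
rewrite [leRHS]mulrCA; apply: ler_wpM2l => //.
by apply: div_sum_model_le => //; lia.
Qed.

Lemma pi_le4 (R : realType) : pi <= 4 :> R.
Proof. by have /andP[_] := (pihalf_02_cos_pihalf R).1; lra. Qed.

Lemma pi_ge1 (R : realType) : 1 <= pi :> R.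
Proof. by have := pi_ge2 R; lra. Qed.

(** Here (a - ps)(a + ps) <= p^2/2 <= 2, while a + ps >= s. It serves for p = sqrt pi, s = sqrt n
    and a = 4^n / c(0). *)
Lemma sqrt_perturbation (R : realType) (p s a : R) :
  1 <= p -> p ^+ 2 <= 4 -> 0 < s -> 0 < a ->
  p ^+ 2 * s ^+ 2 <= a ^+ 2 -> a ^+ 2 <= p ^+ 2 * (s ^+ 2 + 2^-1) ->
  p * s <= a <= p * s + 2 / s.
Proof.
move=> p1 p4 s0 a0 lo up.
have ps0 : 0 <= p * s by rewrite mulr_ge0//; lra.
have pa : p * s <= a.
  by rewrite -(@ler_pXn2r _ 2%N) ?nnegrE ?exprMn// ltW.
rewrite pa /= -lerBlDl ler_pdivlMr//.
have q1 : (a - p * s) * (a + p * s) <= p ^+ 2 / 2.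
  have -> : (a - p * s) * (a + p * s) = a ^+ 2 - p ^+ 2 * s ^+ 2 by ring.
  by lra.
have q2 : s <= a + p * s.
  have : 1 * s <= p * s by rewrite ler_wpM2r// ltW.
  by lra.
have q3 : (a - p * s) * s <= (a - p * s) * (a + p * s) by rewrite ler_wpM2l// subr_ge0.
by lra.
Qed.

Lemma central_ratio_bounds (R : realType) (n : nat) : (0 < n)%N ->
  Num.sqrt pi * Num.sqrt n%:R <= 4 ^+ n / cbin R n
    <= Num.sqrt pi * Num.sqrt n%:R + 2 / Num.sqrt n%:R.
Proof.
move=> n0; have /andP[lo up] := wallis_bounds R n.
have pi2 := pi_ge2 R; have pi4 := pi_le4 R.
have p2 : Num.sqrt pi ^+ 2 = pi :> R by rewrite sqr_sqrtr//; lra.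
have s2 : Num.sqrt n%:R ^+ 2 = n%:R :> R by rewrite sqr_sqrtr.
apply: sqrt_perturbation; rewrite ?p2 ?s2 //.
- by rewrite -[leLHS]sqrtr1 ler_wsqrtr//; lra.
- by rewrite sqrtr_gt0 ltr0n.
- by rewrite divr_gt0 ?exprn_gt0 ?cbin_gt0.
Qed.

Lemma harm_ln_le (R : realType) (n : nat) : (0 < n)%N ->
  `|harm R n - (ln n%:R + euler_gamma R)| <= 2 / n%:R.
Proof.
move=> n0; have := harm_le R n n0.
have x1 : 1 <= n%:R :> R by rewrite ler1n.
move: (n%:R : R) x1 (harm R n) (ln n%:R) (euler_gamma R) => x x1 H L g.
have x0 : 0 < x by lra.
have v0 : 0 <= x^-1 by rewrite invr_ge0 ltW.
have v1 : x^-1 <= 1 by rewrite invf_le1.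
have -> : (2 * x)^-1 = x^-1 / 2 by rewrite invfM mulrC.
have -> : (12 * x ^+ 2)^-1 = x^-1 * x^-1 / 12 by field; lra.
have -> : (x ^+ 4)^-1 = x^-1 * x^-1 * (x^-1 * x^-1) by field; lra.
move: (x^-1) v0 v1 => v v0 v1.
have v2 : v * v <= v by rewrite ler_piMl.
have v20 : 0 <= v * v by rewrite mulr_ge0.
have v21 : v * v <= 1 := le_trans v2 v1.
have v4 : v * v * (v * v) <= v := le_trans (ler_piMl v20 v21) v2.
move: (v * v) (v * v * (v * v)) v20 v2 v4 {v21} => w y v20 v2 v4.
by rewrite !ler_norml => /andP[a b]; apply/andP; split; lra.
Qed.

Lemma main_estimate (R : realType) :
  exists2 C : R, 0 < C & forall n : nat, (3 <= n)%N ->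
  `|nu R n - (Num.sqrt pi * Num.sqrt n%:R - ln n%:R
              + (5 - 6 * euler_gamma R) / 2)| <= C / Num.sqrt n%:R.
Proof.
pose K : R := 4 * (100 * 100) * (105 * 256 * 64 + 256).
have K0 : 0 <= K by rewrite /K !mulr_ge0// addr_ge0// !mulr_ge0.
(* 180 is the product of 30, 2 and 3, the last two from n + 1 <= 2n and 4^n / c(0) <= 3 sqrt n. The
   other errors are 10, 2 and 4 times n^(-1/2), within 20. *)
exists (180 * K + 20) => [|n n3].
  by move: K0; move: K => k k0; lra.
have n0 : (0 < n)%N by lia.
have x3 : 3 <= n%:R :> R by rewrite ler_nat.
have x0 : 0 < n%:R :> R by lra.
have [s sE] : exists s : R, Num.sqrt n%:R = s by exists (Num.sqrt n%:R).
have s0 : 0 < s by rewrite -sE sqrtr_gt0.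
have s2 : s ^+ 2 = n%:R by rewrite -sE sqr_sqrtr// ltW.
have s1 : 1 <= s by rewrite -sE -[leLHS]sqrtr1 ler_wsqrtr//; lra.
rewrite sE.
have vs : n%:R^-1 <= s^-1.
  by rewrite lef_pV2 ?posrE// -s2 expr2 ler_peMl// ltW.
have vn : n.+1%:R^-1 <= s^-1.
  by apply: le_trans vs; rewrite lef_pV2 ?posrE// ler_nat.
have vsn : (Num.sqrt n.+1%:R)^-1 <= s^-1.
  by rewrite lef_pV2 ?posrE ?sqrtr_gt0// -sE ler_wsqrtr// ler_nat.
have nuE : nu R n = 1 + \sum_(1 <= a < n.*2.+2) \sum_(1 <= b < n.*2.+2)
    vbeta R n (a * b).
  by case: n n3 {n0 x3 x0 s sE s0 s2 s1 vs vn vsn} => // n _; rewrite nu_eq doubleS.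
have h1 := vbeta_sum_model_le R n n3; rewrite -/K in h1.
have h2 : `|\sum_(1 <= N < n.*2.+2) div_model R N * vbeta R n N
    - (3 / 2 - 2 * euler_gamma R - harm R n
       + 2 * n%:R / n.+1%:R * rho_sum R n)| <= 10 / s.
  have n2 : (n.+1 < n.*2)%N by lia.
  apply: (le_trans (sum_div_model_beta R n n.*2 n2)).
  have -> : 10 / s = 8 * s^-1 + 2 * s^-1 by ring.
  by apply: lerD; rewrite ler_wpM2l.
have h3 : `|harm R n - (ln n%:R + euler_gamma R)| <= 2 / s.
  apply: (le_trans (harm_ln_le R n n0)); exact: ler_wpM2l.
have /andP[lo up] := central_ratio_bounds R n n0; rewrite sE in lo up.
have c0 := cbin_gt0 R n.
set a := 4 ^+ n / cbin R n in lo up.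
have a0 : 0 <= a by rewrite divr_ge0 ?exprn_ge0// ltW.
have a3 : a <= 3 * s.
  have : a ^+ 2 <= (3 * s) ^+ 2.
    have /andP[_] := wallis_bounds R n; rewrite -/a => h; apply: (le_trans h).
    rewrite exprMn s2; have := pi_le4 R; have := pi_ge1 R; nra.
  by rewrite ler_pXn2r// nnegrE mulr_ge0// ltW.
have h4 : `|2 * n%:R / n.+1%:R * rho_sum R n - Num.sqrt pi * s| <= 4 / s.
  have -> : 2 * n%:R / n.+1%:R * rho_sum R n = a - a / (2 * n%:R + 1).
    have e : n.*2.+1%:R = 2 * n%:R + 1 :> R by rewrite -natr1 -mul2n natrM.
    rewrite /rho_sum /a e -natr1; field.
    by rewrite (gt_eqF c0) /=; do ?(apply/andP; split); lra.
  have b0 : 0 <= a / (2 * n%:R + 1) by rewrite divr_ge0//; lra.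
  have b1 : a / (2 * n%:R + 1) <= 2 / s.
    rewrite ler_pdivrMr; last by lra.
    apply: (le_trans a3); rewrite -s2.
    have -> : 2 / s * (2 * s ^+ 2 + 1) = 4 * s + 2 / s by field; rewrite gt_eqF.
    have : 0 < 2 / s by rewrite divr_gt0.
    by lra.
  have -> : 4 / s = 2 / s + 2 / s by ring.
  have w0 : 0 < 2 / s by rewrite divr_gt0.
  move: lo up b0 b1 w0; move: (Num.sqrt pi * s) (a / (2 * n%:R + 1)) (2 / s) => u v w *.
  by rewrite ler_norml; apply/andP; split; lra.
have h5 : n.+1%:R / cbin R n * (30 * (K * (4 ^+ n / n%:R ^+ 2))) <= 180 * K / s.
  have -> : n.+1%:R / cbin R n * (30 * (K * (4 ^+ n / n%:R ^+ 2))) =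
      30 * K * (n.+1%:R / n%:R * (a / n%:R)).
    by rewrite /a; field; rewrite !gt_eqF.
  have -> : 180 * K / s = 30 * K * (2 * (3 / s)) by ring.
  apply: ler_wpM2l; first by rewrite mulr_ge0.
  apply: ler_pM; rewrite ?divr_ge0//.
    by rewrite ler_pdivrMr// -natr1; lra.
  rewrite ler_pdivrMr// -s2.
  by have -> : 3 / s * s ^+ 2 = 3 * s by field; rewrite gt_eqF.
rewrite nuE; move: h1 h2 h3 h4 h5; have w0 : 0 < s^-1 by rewrite invr_gt0.
have -> : (180 * K + 20) / s = 180 * K / s + 20 * s^-1 by ring.
move: (180 * K / s) (n.+1%:R / cbin R n * _) => k1 k2.
move: (\sum_(1 <= a < _) _) (\sum_(1 <= N < _) _) => S M.
move: (2 * n%:R / n.+1%:R * rho_sum R n) (Num.sqrt pi * s) (harm R n) (ln n%:R) (s^-1) w0.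
move=> r p H L w w0.
rewrite !ler_norml => /andP[a1 b1] /andP[a2 b2] /andP[a3' b3] /andP[a4 b4] h5.
by apply/andP; split; lra.
Qed.

Theorem theorem10 (R : realType) :
  (fun n : nat =>
     nu R n - (Num.sqrt (pi : R) * Num.sqrt (n%:R : R) - ln (n%:R : R)
               + (5 - 6 * euler_gamma R) / 2))
  =O_\oo (fun n : nat => (n%:R : R) `^ (- 2^-1)).
Proof.
have [C C0 hC] := main_estimate R.
apply/eqO_exP; exists C => //.
exists 3%N => // n /= n3; apply: (le_trans (hC n n3)).
by rewrite powRN powR12_sqrt// [X in _ <= C * X]ger0_norm// invr_ge0 sqrtr_ge0.
Qed.
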